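(* Let $\theta_1,\theta_2\in[0,2\pi)$ and $\sigma_1,\sigma_2>0$. Let $\mathcal M=\mathcal M_0\oplus\mathcal M_1$ and $\mathcal N=\mathcal N_0\oplus\mathcal N_1$ be nonzero closed invariant subspaces, each of lifted Type I or lifted Type II, for the $3$-Brownian shifts $T_{\sigma_1,\theta_1}$ and $T_{\sigma_2,\theta_2}$, respectively, with associated Hilbert spaces $\mathcal E_{\mathcal M}$ and $\mathcal E_{\mathcal N}$. Then $$T_{\sigma_1,\theta_1}\big|_{\mathcal M}\cong T_{\sigma_2,\theta_2}\big|_{\mathcal N}$$ if and only if $\sigma_1=\sigma_2$, $\dim\mathcal E_{\mathcal M}=\dim\mathcal E_{\mathcal N}$, and one of the following holds: (i) both $\mathcal M$ and $\mathcal N$ are of lifted Type I; (ii) both $\mathcal M$ and $\mathcal N$ are of lifted Type II, that is, $$\mathcal M_0=\varphi^{(1)}_{z_2}H^2(\mathbb D^2)\oplus g^{(1)}_{z_2}H^2_{z_1}(\mathbb D)\oplus\Psi^{(1)}H^2(\mathbb D;\mathcal E_{\mathcal M}),\qquad \mathcal N_0=\varphi^{(2)}_{z_2}H^2(\mathbb D^2)\oplus g^{(2)}_{z_2}H^2_{z_1}(\mathbb D)\oplus\Psi^{(2)}H^2(\mathbb D;\mathcal E_{\mathcal N}),$$ $$\mathcal M_1=\mathbb C\begin{bmatrix}g^{(1)}\\1\end{bmatrix}\oplus\bigl(\varphi^{(1)}H^2(\mathbb D)\oplus\{0\}\bigr),\qquad \mathcal N_1=\mathbb C\begin{bmatrix}g^{(2)}\\1\end{bmatrix}\oplus\bigl(\varphi^{(2)}H^2(\mathbb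 D)\oplus\{0\}\bigr),$$ with $$g^{(j)}(z)=\sigma_j\,\frac{\overline{\varphi^{(j)}(e^{i\theta_j})}\,\varphi^{(j)}(z)-1}{z-e^{i\theta_j}},\qquad j=1,2,$$ for some inner functions $\varphi^{(j)}\in H^\infty(\mathbb D)$ and some operator-valued inner functions $\Psi^{(1)}\in H^\infty(\mathbb D;\mathcal B(\mathcal E_{\mathcal M},K_{\varphi^{(1)}}))$ with $\Psi^{(1)}(0)\mathcal E_{\mathcal M}\subset (g^{(1)})^{\perp}\subset K_{\varphi^{(1)}}$ and $\Psi^{(2)}\in H^\infty(\mathbb D;\mathcal B(\mathcal E_{\mathcal N},K_{\varphi^{(2)}}))$ with $\Psi^{(2)}(0)\mathcal E_{\mathcal N}\subset (g^{(2)})^{\perp}\subset K_{\varphi^{(2)}}$, and moreover $$\theta_1=\theta_2,\qquad \|g^{(1)}\|=\|g^{(2)}\|.$$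
   Context: All Hilbert spaces are complex and separable. $H^2(\mathbb D)$, $H^2(\mathbb D^2)$ are the Hardy spaces of the unit disk and bidisk (power series with square-summable coefficients, $\ell^2$ coefficient norm); $H^2(\mathbb D;E)$ is the $E$-valued Hardy space on $\mathbb D$; $H^\infty(\mathbb D;\mathcal B(E,F))$ is the space of bounded analytic $\mathcal B(E,F)$-valued functions. $\Psi\in H^\infty(\mathbb D;\mathcal B(E,F))$ is inner if $M_\Psi:H^2(\mathbb D;E)\to H^2(\mathbb D;F)$, $(M_\Psi f)(z)=\Psi(z)f(z)$, is an isometry. For a scalar inner function $\varphi$, $K_\varphi:=H^2(\mathbb D)\ominus\varphi H^2(\mathbb D)$. For $\sigma>0$, $\theta\in[0,2\pi)$, the $3$-Brownian shift $T_{\sigma,\theta}$ acts on $H^2(\mathbb D^2)\oplus H^2(\mathbb D)\oplus\mathbb C$ by $$T_{\sigma,\theta}(F,f,\alpha)=(z_1F+\sigma f_{z_2},\ zf+\sigma\alpha,\ e^{i\theta}\alpha).$$ For a one-variable function $f$, $f_{z_2}(z_1,z_2):=f(z_2)$. $H^2_{z_1}(\mathbb D)\subset H^2(\mathbb D^2)$ is the closed subspace of functions $(z_1,z_2)\mapsto h(z_1)$, $h\in H^2(\mathbb D)$. We identify $H^2(\mathbb D^2)\cong H^2(\mathbb D;H^2(\mathbb D))$ with respect to the variable $z_1$ (values being functions of $z_2$), so that for a closed subspace $K\subset H^2(\mathbb D)$, $H^2(\mathbb D;K)\subset H^2(\mathbb D^2)$, and $M_{z_1}$ becomes the shift. Lifted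 types. A closed $T_{\sigma,\theta}$-invariant subspace $\mathcal M=\mathcal M_0\oplus\mathcal M_1$, with $\mathcal M_0\subset H^2(\mathbb D^2)$, $\mathcal M_1\subset H^2(\mathbb D)\oplus\mathbb C$, is of: - lifted Type I if there are an inner function $\varphi\in H^\infty(\mathbb D)$, a Hilbert space $\mathcal E_{\mathcal M}$ (possibly $\{0\}$) and an inner $\Psi\in H^\infty(\mathbb D;\mathcal B(\mathcal E_{\mathcal M},K_\varphi))$ with $\mathcal M_1=\varphi H^2(\mathbb D)\oplus\{0\}$ and $\mathcal M_0=\varphi_{z_2}H^2(\mathbb D^2)\oplus\Psi H^2(\mathbb D;\mathcal E_{\mathcal M})$; - lifted Type II if there are an inner function $\varphi\in H^\infty(\mathbb D)$ for which the boundary value $\varphi(e^{i\theta})$ exists and $g(z)=\sigma\frac{\overline{\varphi(e^{i\theta})}\varphi(z)-1}{z-e^{i\theta}}$ belongs to $H^2(\mathbb D)$ (then $g\in K_\varphi$), a Hilbert space $\mathcal E_{\mathcal M}$ (possibly $\{0\}$) and an inner $\Psi\in H^\infty(\mathbb D;\mathcal B(\mathcal E_{\mathcal M},K_\varphi))$ with $\Psi(0)\mathcal E_{\mathcal M}\subset g^\perp$ (orthogonal complement in $K_\varphi$), such that $\mathcal M_1=\mathbb C\begin{bmatrix}g\\1\end{bmatrix}\oplus(\varphi H^2(\mathbb D)\oplus\{0\})$ and $\mathcal M_0=\varphi_{z_2}H^2(\mathbb D^2)\oplus g_{z_2}H^2_{z_1}(\mathbb D)\oplus\Psi H^2(\mathbb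 D;\mathcal E_{\mathcal M})$. All sums $\oplus$ are orthogonal direct sums. $T_{\sigma_1,\theta_1}|_{\mathcal M}\cong T_{\sigma_2,\theta_2}|_{\mathcal N}$ means there is a unitary $U:\mathcal M\to\mathcal N$ with $U\,T_{\sigma_1,\theta_1}|_{\mathcal M}=T_{\sigma_2,\theta_2}|_{\mathcal N}\,U$. $\dim$ denotes Hilbert space dimension. *)

(* Defs.v *)
From HB Require Import structures.
From mathcomp Require Import all_boot all_order all_algebra.
From mathcomp Require Import all_classical all_reals.
From mathcomp Require Import topology normedtype sequences realfun trigo.
From mathcomp Require Import complex ring.

Set Implicit Arguments.
Unset Strict Implicit.
Unset Printing Implicit Defensive.

Import Order.TTheory GRing.Theory Num.Theory.
Import numFieldNormedType.Exports.

Local Open Scope classical_set_scope.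
Local Open Scope ring_scope.

Section CauchySchwarz.
Context (C : numClosedFieldType) (V : lmodType C) (dot : V -> V -> C)
  (dotDZl : forall a x y z, dot (a *: x + y) z = a * dot x z + dot y z)
  (dotC : forall x y, dot y x = Num.conj (dot x y))
  (dotxx_ge0 : forall x, 0 <= dot x x)
  (dotxx_eq0 : forall x, dot x x = 0 -> x = 0).

Lemma form_Dl x y z : dot (x + y) z = dot x z + dot y z.
Proof. by rewrite -[x in LHS]scale1r dotDZl mul1r. Qed.

Lemma form_0l z : dot 0 z = 0.
Proof. by apply: (addrI (dot 0 z)); rewrite -form_Dl !addr0. Qed.

Lemma form_Zl a x z : dot (a *: x) z = a * dot x z.
Proof. by rewrite -[a *: x]addr0 dotDZl form_0l addr0. Qed.

Lemma form_Dr x y z : dot z (x + y) = dot z x + dot z y.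
Proof. by rewrite dotC form_Dl rmorphD /= -!dotC. Qed.

Lemma form_Zr a x z : dot z (a *: x) = Num.conj a * dot z x.
Proof. by rewrite dotC form_Zl rmorphM /= -dotC. Qed.

Lemma form_CauchySchwarz x y : `|dot x y| ^+ 2 <= dot x x * dot y y.
Proof.
have [/eqP y0|ny0] := eqVneq (dot y y) 0.
  have -> : y = 0 by apply: dotxx_eq0; apply/eqP.
  by rewrite [in X in X <= _]dotC !form_0l conjC0 normr0 expr0n mulr0.
have y_gt0 : 0 < dot y y by rewrite lt_def ny0 dotxx_ge0.
rewrite -subr_ge0 -(pmulr_lge0 _ y_gt0).
have := dotxx_ge0 (dot y y *: x - dot x y *: y).
rewrite -scaleNr form_Dl !form_Dr !form_Zl !form_Zr (dotC x y) rmorphN /=.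
rewrite normCK (CrealP (ger0_real (ltW y_gt0))).
congr (_ <= _); ring.
Qed.

End CauchySchwarz.

(* Linear in the first variable, conjugate-linear in the second. *)
HB.mixin Record NormedModule_isInner (C : numClosedFieldType) V
    & NormedModule C V := {
  dot : V -> V -> C;
  dotDZl : forall (a : C) (x y z : V), dot (a *: x + y) z = a * dot x z + dot y z;
  dotC : forall x y : V, dot y x = Num.conj (dot x y);
  dotxx : forall x : V, dot x x = `|x| ^+ 2
}.

#[short(type="innerType")]
HB.structure Definition Inner (C : numClosedFieldType) :=
  {V of NormedModule C V & NormedModule_isInner C V}.

#[short(type="hilbertType")]
HB.structure Definition Hilbert (C : numClosedFieldType) :=
  {V of Inner C V & Complete V}.

HB.factory Record Lmodule_isInner (C : numClosedFieldType) V
    & GRing.Lmodule C V := {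
  dot : V -> V -> C;
  dotDZl : forall (a : C) (x y z : V), dot (a *: x + y) z = a * dot x z + dot y z;
  dotC : forall x y : V, dot y x = Num.conj (dot x y);
  dotxx_ge0 : forall x : V, 0 <= dot x x;
  dotxx_eq0 : forall x : V, dot x x = 0 -> x = 0
}.

HB.builders Context C V & Lmodule_isInner C V.

Let nrm (x : V) : C := sqrtC (dot x x).

Let dotDl := form_Dl dotDZl.
Let dotZl := form_Zl dotDZl.
Let dotDr := form_Dr dotDZl dotC.
Let dotZr := form_Zr dotDZl dotC.
Let CauchySchwarz := form_CauchySchwarz dotDZl dotC dotxx_ge0 dotxx_eq0.

Let nrm_ge0 x : 0 <= nrm x.
Proof. by rewrite sqrtC_ge0 dotxx_ge0. Qed.

Let nrmD x y : nrm (x + y) <= nrm x + nrm y.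
Proof.
rewrite -(@ler_pXn2r _ 2) ?nnegrE ?addr_ge0 ?nrm_ge0//.
rewrite sqrrD !sqrtCK dotDl !dotDr.
have le_xy : `|dot x y| <= nrm x * nrm y.
  rewrite -(@ler_pXn2r _ 2) ?nnegrE ?mulr_ge0 ?nrm_ge0 ?normr_ge0//.
  by rewrite exprMn !sqrtCK CauchySchwarz.
have le_Re : dot x y + dot y x <= `|dot x y| *+ 2.
  have Rreal : dot x y + dot y x \is Num.real.
    by rewrite CrealE rmorphD /= -!dotC addrC.
  apply: (le_trans (real_ler_norm Rreal)).
  by rewrite (le_trans (ler_normD _ _))// [in X in _ + `|X|]dotC norm_conjC mulr2n.
have -> : dot x x + dot x y + (dot y x + dot y y) =
  dot x x + (dot x y + dot y x) + dot y y by ring.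
rewrite lerD2r lerD2l (le_trans le_Re)//.
by rewrite lerMn2r le_xy orbT.
Qed.

Let nrmZ (a : C) x : nrm (a *: x) = `|a| * nrm x.
Proof.
apply/eqP; rewrite -(@eqrXn2 _ 2) ?mulr_ge0 ?nrm_ge0 ?normr_ge0//.
by rewrite exprMn !sqrtCK dotZl dotZr normCK mulrA.
Qed.

Let nrm0_eq0 x : nrm x = 0 -> x = 0.
Proof. by move/eqP; rewrite sqrtC_eq0 => /eqP/dotxx_eq0. Qed.

HB.instance Definition _ := Lmodule_isNormed.Build C V nrmD nrmZ nrm0_eq0.

Let dotxx (x : V) : dot x x = `|x| ^+ 2.
Proof. by rewrite sqrtCK. Qed.

HB.instance Definition _ := NormedModule_isInner.Build C V dotDZl dotC dotxx.

HB.end.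

Section scalars.
Context (C : numClosedFieldType).

Let cdot (x y : C^o) : C := x * Num.conj (y : C).

Let cdotDZl (a : C) (x y z : C^o) : cdot (a *: x + y) z = a * cdot x z + cdot y z.
Proof. by rewrite /cdot mulrDl -mulrA. Qed.

Let cdotC (x y : C^o) : cdot y x = Num.conj (cdot x y).
Proof. by rewrite /cdot rmorphM /= conjCK mulrC. Qed.

Let cdotxx (x : C^o) : cdot x x = `|x| ^+ 2.
Proof. by rewrite /cdot -normCK. Qed.

HB.instance Definition _ := NormedModule_isInner.Build C C^o cdotDZl cdotC cdotxx.

End scalars.

Section complex_numbers.
Context (R : realType).

Lemma norm_ReIm (z : R[i]) :
  `|z| <= (`|complex.Re z| + `|complex.Im z|)%:C%C.
Proof.
rewrite {1}[z]complexE (le_trans (ler_normD _ _))// rmorphD /= lerD//.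
  by rewrite normc_def /= expr0n addr0 sqrtr_sqr.
rewrite normrM normc_def /= expr0n expr1n add0r sqrtr1 mul1r.
by rewrite normc_def /= expr0n addr0 sqrtr_sqr.
Qed.

Lemma norm_ge_Im (z : R[i]) : `|complex.Im z|%:C%C <= `|z|.
Proof.
rewrite normc_def lecR -sqrtr_sqr ler_sqrt ?addr_ge0 ?sqr_ge0//.
by rewrite lerDr sqr_ge0.
Qed.

Lemma complex_pos (e : R[i]) : 0 < e -> exists2 d : R, 0 < d & e = d%:C%C.
Proof.
by case: e => a b; rewrite ltcE /= => /andP[/eqP -> a0]; exists a.
Qed.

Lemma cvg_complex (T : Type) (F : set_system T) (FF : Filter F)
    (u : T -> R[i]^o) (a b : R) :
  (fun t => complex.Re (u t)) @ F --> a ->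
  (fun t => complex.Im (u t)) @ F --> b -> u @ F --> ((a +i* b)%C : R[i]^o).
Proof.
move=> Fa Fb; apply/cvgrPdist_lt => _ /complex_pos[d d0 ->].
have d20 : 0 < d / 2 by rewrite divr_gt0.
move/cvgrPdist_lt : Fa => /(_ _ d20) Fa; move/cvgrPdist_lt : Fb => /(_ _ d20) Fb.
near=> z; rewrite (le_lt_trans (norm_ReIm _))// ltcR [ltRHS]splitr ltrD//.
  by rewrite raddfB /=; near: z.
by rewrite raddfB /=; near: z.
Unshelve. all: by end_near. Qed.

Lemma complex_complete (F : set_system R[i]^o) :
  ProperFilter F -> cauchy F -> cvg F.
Proof.
move=> FF /cauchyP Fc.
have part (p : R[i] -> R) : (forall x y, p (x - y) = p x - p y) ->
    (forall z, `|p z|%:C%C <= `|z|) -> cvg (p @ F).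
  move=> pB pn; apply: cauchy_cvg; apply: cauchy_exP => e e0.
  have [x Fx] := Fc e%:C%C ltac:(by rewrite ltcR).
  exists (p x); change (F (p @^-1` ball (p x) e)); apply: filterS Fx => y.
  rewrite /preimage -!ball_normE /= => xy.
 by rewrite -ltcR -pB (le_lt_trans (pn _)).
have /cvg_ex[a Fa] :=
  part (@complex.Re R) (fun x y => raddfB (@complex.Re R) x y) (@normc_ge_Re R).
have /cvg_ex[b Fb] :=
  part (@complex.Im R) (fun x y => raddfB (@complex.Im R) x y) norm_ge_Im.
by apply/cvg_ex; exists (a +i* b)%C; exact: cvg_complex.
Qed.

HB.instance Definition _ := Uniform_isComplete.Build R[i]^o complex_complete.

End complex_numbers.


Section inner_theory.
Context (C : numClosedFieldType) (E : innerType C).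
Implicit Types x y z : E.

Lemma dotDl x y z : dot (x + y) z = dot x z + dot y z.
Proof. exact: (form_Dl (@dotDZl C E)). Qed.

Lemma dot0l x : dot 0 x = 0.
Proof. exact: (form_0l (@dotDZl C E)). Qed.

Lemma dotZl a x y : dot (a *: x) y = a * dot x y.
Proof. exact: (form_Zl (@dotDZl C E)). Qed.

Lemma dotDr x y z : dot z (x + y) = dot z x + dot z y.
Proof. exact: (form_Dr (@dotDZl C E) (@dotC C E)). Qed.

Lemma dotZr a x y : dot x (a *: y) = Num.conj a * dot x y.
Proof. exact: (form_Zr (@dotDZl C E) (@dotC C E)). Qed.

Lemma dot_ge0 x : 0 <= dot x x.
Proof. by rewrite dotxx exprn_ge0. Qed.

Lemma dot_eq0 x : dot x x = 0 -> x = 0.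
Proof. by move/eqP; rewrite dotxx sqrf_eq0 normr_eq0 => /eqP. Qed.

Lemma CauchySchwarz x y : `|dot x y| <= `|x| * `|y|.
Proof.
rewrite -(@ler_pXn2r _ 2) ?nnegrE ?mulr_ge0//.
rewrite exprMn -!dotxx.
exact: (form_CauchySchwarz (@dotDZl C E) (@dotC C E) dot_ge0 dot_eq0).
Qed.

End inner_theory.

Section complex_limits.
Context (R : realType).

Lemma cvg_Re (T : Type) (F : set_system T) (FF : Filter F)
    (u : T -> R[i]^o) (l : R[i]) :
  u @ F --> (l : R[i]^o) -> (fun t => complex.Re (u t)) @ F --> complex.Re l.
Proof.
move=> /cvgrPdist_lt Fl; apply/cvgrPdist_lt => e e0.
have := Fl e%:C%C; rewrite ltcR => /(_ e0); apply: filterS => t.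
by rewrite -ltcR -raddfB; apply: le_lt_trans; exact: normc_ge_Re.
Qed.

Lemma is_cvg_complex_series (c : nat -> R[i]^o) (r : nat -> R) :
  (forall n, `|c n| <= (r n)%:C%C) -> cvgn (series r) -> cvgn (series c).
Proof.
move=> cr cvr.
have r0 n : 0 <= r n by rewrite -lecR; exact: le_trans (normr_ge0 _) (cr n).
have part (p : {additive R[i] -> R}) :
    (forall z, `|p z|%:C%C <= `|z|) -> cvgn (p \o series c).
  move=> pn; rewrite (_ : p \o _ = series (p \o c)); last first.
    by apply/funext => n; rewrite /series /= raddf_sum.
  apply: normed_cvg; apply: series_le_cvg cvr => [n|//|n]; rewrite /mk_sequence.
    exact: normr_ge0.
  by rewrite -lecR; exact: le_trans (pn _) (cr n).
have /cvg_ex[a Fa] := part (@complex.Re R) (@normc_ge_Re R).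
have /cvg_ex[b Fb] := part (@complex.Im R) (@norm_ge_Im R).
by apply/cvg_ex; exists (a +i* b)%C; exact: cvg_complex.
Qed.

End complex_limits.

Section hardy_def.
Context (R : realType) (E : innerType R[i]).

Definition normsq (x : E) : R := complex.Re (`|x| ^+ 2).

Definition square_summable : {pred nat -> E} :=
  [pred f : nat -> E | `[< cvgn (series (normsq \o f)) >]].

(* H^2(D; E): the sequence f stands for the power series \sum_n f_n z^n. *)
Record hardy := Hardy {
  hardy_coef :> nat -> E;
  hardy_coefP : hardy_coef \in square_summable }.

Lemma normsqE x : (normsq x)%:C%C = `|x| ^+ 2.
Proof. by rewrite /normsq RRe_real// ger0_real// exprn_ge0. Qed.

Lemma normsq_ge0 x : 0 <= normsq x.
Proof. by rewrite -lecR normsqE exprn_ge0. Qed.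

Lemma normsqD x y : normsq (x + y) <= 2 * normsq x + 2 * normsq y.
Proof.
rewrite -lecR rmorphD !rmorphM /= !normsqE rmorph_nat.
rewrite (le_trans (lerXn2r _ _ _ (ler_normD x y))) ?nnegrE ?addr_ge0//.
rewrite -subr_ge0 [X in 0 <= X](_ : _ = (`|x| - `|y|) ^+ 2); last by ring.
by rewrite -realEsqr rpredB// ger0_real.
Qed.

Lemma normsqZ a x : normsq (a *: x) = complex.Re (`|a| ^+ 2) * normsq x.
Proof.
apply: (@complexI R).
have CM u v : (u * v)%:C%C = u%:C%C * v%:C%C :> R[i] by exact: rmorphM.
by rewrite CM !normsqE normrZ exprMn RRe_real// ger0_real// exprn_ge0.
Qed.

Lemma square_summableP (f : nat -> E) :
  reflect (cvgn (series (normsq \o f))) (f \in square_summable).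
Proof. exact: asboolP. Qed.

Fact square_summable_closed : GRing.submod_closed square_summable.
Proof.
split.
  apply/square_summableP; rewrite (_ : series _ = cst 0).
    exact: is_cvg_cst.
  apply/funext => n; rewrite /series /= big1// => k _.
  by rewrite /normsq normr0 expr0n.
move=> a f g /square_summableP ff /square_summableP gg.
apply/square_summableP.
apply: (@series_le_cvg _ _ (fun n =>
    2 * complex.Re (`|a| ^+ 2) * normsq (f n) + 2 * normsq (g n))) => [n|n|n|].
- exact: normsq_ge0.
- rewrite addr_ge0 ?mulr_ge0 ?normsq_ge0// -lecR RRe_real// ?ger0_real//.
    by rewrite exprn_ge0.
  by rewrite exprn_ge0.
- by rewrite -mulrA -normsqZ; exact: normsqD.
- by apply: is_cvg_seriesD; apply: is_cvg_seriesZ.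
Qed.

HB.instance Definition _ :=
  GRing.isSubmodClosed.Build R[i] (nat -> E) square_summable
    square_summable_closed.
HB.instance Definition _ := [isSub for hardy_coef].
HB.instance Definition _ := [Choice of hardy by <:].
HB.instance Definition _ := [SubChoice_isSubLmodule of hardy by <:].

Implicit Types f g h : hardy.

Lemma hardyP f g : (forall n, f n = g n) -> f = g.
Proof. by move=> fg; apply: val_inj; apply/funext. Qed.

Lemma hardyDE f g n : (f + g) n = f n + g n. Proof. by []. Qed.
Lemma hardyNE f n : (- f) n = - f n. Proof. by []. Qed.
Lemma hardyZE a f n : (a *: f) n = a *: f n. Proof. by []. Qed.
Lemma hardy0E n : (0 : hardy) n = 0. Proof. by []. Qed.

Lemma cvg_normsq f : cvgn (series (normsq \o f)).
Proof. exact/square_summableP/hardy_coefP. Qed.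

Definition hardy_dot f g : R[i] :=
  limn (series (fun n => dot (f n) (g n) : R[i]^o)).

Lemma is_cvg_hardy_dot f g : cvgn (series (fun n => dot (f n) (g n) : R[i]^o)).
Proof.
apply: (@is_cvg_complex_series _ _ (fun n => normsq (f n) + normsq (g n))).
  move=> n; rewrite (le_trans (CauchySchwarz _ _))// rmorphD /= !normsqE.
  set a := `|f n|; set b := `|g n|.
  have ab0 : 0 <= a * b by rewrite mulr_ge0 ?normr_ge0.
  rewrite -subr_ge0.
  rewrite [X in 0 <= X](_ : _ = (a - b) ^+ 2 + a * b); last by ring.
  by rewrite addr_ge0// -realEsqr rpredB// ger0_real// normr_ge0.
by apply: is_cvg_seriesD; exact: cvg_normsq.
Qed.

Fact hardy_dotDZl a f g h :
  hardy_dot (a *: f + g) h = a * hardy_dot f h + hardy_dot g h.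
Proof.
apply: (@cvg_lim R[i]^o) => //.
rewrite (_ : series _ =
    a *: series (fun n => dot (f n) (h n) : R[i]^o) +
         series (fun n => dot (g n) (h n) : R[i]^o)).
  by apply: cvgD; [apply: cvgZr|]; exact: is_cvg_hardy_dot.
apply/funext => n; rewrite !fctE /= /series /= scaler_sumr -big_split /=.
by apply: eq_bigr => k _; rewrite dotDZl.
Qed.

Fact hardy_dotC f g : hardy_dot g f = Num.conj (hardy_dot f g).
Proof.
apply: (@cvg_lim R[i]^o) => //; apply/cvgrPdist_lt => e e0.
have /(@cvgrPdist_lt _ R[i]^o)/(_ _ e0) := @is_cvg_hardy_dot f g.
apply: filterS => n; rewrite -norm_conjC rmorphB /=.
congr (`| _ - _ | < _).
rewrite /series /= rmorph_sum /=; apply: eq_bigr => k _.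
by rewrite -dotC.
Qed.

Lemma hardy_dotxx f :
  hardy_dot f f = (limn (series (normsq \o f)))%:C%C.
Proof.
apply: (@cvg_lim R[i]^o) => //; apply: cvg_complex => /=.
  rewrite (_ : (fun t => _) = series (normsq \o f)); first exact: cvg_normsq.
  apply/funext => n; rewrite /series /= raddf_sum /=.
  by apply: eq_bigr => k _; rewrite /normsq dotxx.
rewrite (_ : (fun t => _) = cst 0); first exact: cvg_cst.
apply/funext => n; rewrite /series /= raddf_sum /= big1// => k _.
by rewrite dotxx -normsqE.
Qed.

Lemma normsq_le_lim f N :
  series (normsq \o f) N <= limn (series (normsq \o f)).
Proof.
apply: nondecreasing_cvgn_le; last exact: cvg_normsq.
apply/nondecreasing_seqP => n; rewrite seriesEnat /= big_nat_recr//=.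
by rewrite lerDl normsq_ge0.
Qed.

Fact hardy_dot_ge0 f : 0 <= hardy_dot f f.
Proof.
rewrite hardy_dotxx lecR (le_trans _ (normsq_le_lim f 0))//.
by rewrite /series /= big_geq.
Qed.

Lemma normsq_coef_le f n : normsq (f n) <= limn (series (normsq \o f)).
Proof.
rewrite (le_trans _ (normsq_le_lim f n.+1))// seriesEnat /= big_nat_recr//=.
by rewrite lerDr sumr_ge0// => k _; exact: normsq_ge0.
Qed.

Fact hardy_dot_eq0 f : hardy_dot f f = 0 -> f = 0.
Proof.
rewrite hardy_dotxx => -[f0]; apply: hardyP => n; rewrite hardy0E.
have := normsq_coef_le f n; rewrite f0 -lecR normsqE => fn0.
by apply/eqP; rewrite -normr_eq0 -sqrf_eq0 eq_le fn0 exprn_ge0 ?normr_ge0.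
Qed.

HB.instance Definition _ := Lmodule_isInner.Build R[i] hardy
  hardy_dotDZl hardy_dotC hardy_dot_ge0 hardy_dot_eq0.

Lemma hardy_normE f : `|f| ^+ 2 = (limn (series (normsq \o f)))%:C%C.
Proof. by rewrite -dotxx -hardy_dotxx. Qed.

Lemma hardy_norm_coef f n : `|f n| <= `|f|.
Proof.
rewrite -(@ler_pXn2r _ 2) ?nnegrE ?normr_ge0//.
by rewrite hardy_normE -normsqE lecR normsq_coef_le.
Qed.

End hardy_def.

Arguments normsq {R E} x.
Arguments square_summable {R E}.

Section hardy_complete.
Context (R : realType) (E : hilbertType R[i]).

Let cvg_normsq_fun (T : Type) (F : set_system T) (FF : Filter F)
    (u : T -> E) (l : E) :
  u @ F --> l -> (fun t => normsq (u t)) @ F --> normsq l.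
Proof.
move=> ul; apply: (@cvg_Re R T F FF (fun t => `|u t| ^+ 2 : R[i]^o)).
have nl : (fun t => `|u t| : R[i]^o) @ F --> (`|l| : R[i]^o).
  exact: cvg_norm.
exact: (cvgZ nl nl).
Qed.

Fact hardy_complete (F : set_system (hardy E)) :
  ProperFilter F -> cauchy F -> cvg F.
Proof.
move=> FF /cauchyP Fc.
have cvc n : cvg ((fun f : hardy E => f n) @ F).
  apply: cauchy_cvg; apply: cauchy_exP => e e0; have [x Fx] := Fc _ e0.
  exists (x n); change (F ((fun f : hardy E => f n) @^-1` ball (x n) e)).
  apply: filterS Fx => y; rewrite /preimage -!ball_normE /=.
  by apply: le_lt_trans; exact: (hardy_norm_coef (x - y)).
pose g n := lim ((fun f : hardy E => f n) @ F).
have key (e : R) (x : hardy E) : 0 < e -> F (ball x e%:C%C) -> forall N,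
    series (fun n => normsq (x n - g n)) N <= e ^+ 2.
  move=> e0 Fx N.
  have cv : (fun f : hardy E => series (fun n => normsq (x n - f n)) N) @ F
      --> series (fun n => normsq (x n - g n)) N.
    rewrite /series /=; apply: cvg_big => [|n _]; first exact: add_continuous.
    apply: cvg_normsq_fun; apply: cvgB; first exact: cvg_cst.
    exact: cvc.
  rewrite -(cvg_lim _ cv)//; apply: limr_le.
    by apply/cvg_ex; eexists; exact: cv.
  apply: filterS Fx => f; rewrite -ball_normE /= => xf.
  apply: (le_trans (normsq_le_lim (x - f) N)).
  rewrite -lecR -hardy_normE rmorphXn /=.
  by rewrite lerXn2r ?nnegrE ?normr_ge0 ?lecR ?(ltW e0) ?(ltW xf).
have memB (e : R) (x : hardy E) : 0 < e -> F (ball x e%:C%C) ->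
    (fun n => x n - g n) \in square_summable.
  move=> e0 Fx; apply/square_summableP; apply: nondecreasing_is_cvgn.
    apply/nondecreasing_seqP => n; rewrite !seriesEnat /= big_nat_recr//=.
    by rewrite lerDl normsq_ge0.
  by exists (e ^+ 2) => _ [n _ <-]; exact: key Fx n.
have gP : g \in square_summable.
  have [x Fx] := Fc 1%:C%C ltac:(by rewrite ltcR).
  have -> : g = (x : nat -> E) - (fun n => x n - g n).
    by apply/funext => n; rewrite !fctE subKr.
  by rewrite rpredB ?hardy_coefP//; exact: memB Fx.
apply/cvg_ex; exists (Hardy gP); apply/cvgrPdist_lt => _ /complex_pos[d d0 ->].
have d20 : 0 < d / 2 by rewrite divr_gt0.
have [x Fx] := Fc (d / 2)%:C%C ltac:(by rewrite ltcR).
have xg : `|x - Hardy gP| <= (d / 2)%:C%C.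
  rewrite -(@ler_pXn2r _ 2) ?nnegrE ?normr_ge0 ?lecR ?(ltW d20)//.
  have -> : (d / 2)%:C%C ^+ 2 = ((d / 2) ^+ 2)%:C%C :> R[i] by rewrite rmorphXn.
  rewrite hardy_normE lecR; apply: limr_le.
    exact: cvg_normsq.
  by apply: nearW => N; exact: key Fx N.
apply: filterS Fx => y; rewrite -ball_normE /= => xy.
rewrite (le_lt_trans (ler_distD x _ _))// [d]splitr rmorphD /=.
by rewrite ler_ltD// distrC.
Qed.

HB.instance Definition _ :=
  Uniform_isComplete.Build (hardy E) hardy_complete.

End hardy_complete.

(* The Hilbert space direct sum; unlike the product normed module E * F, whose
   norm is the maximum of the norms, it carries the l^2 norm. *)
Definition hsum (E F : Type) : Type := (E * F)%type.

Section hsum_inner.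
Context (C : numClosedFieldType) (E F : innerType C).

HB.instance Definition _ := GRing.Lmodule.copy (hsum E F) (E * F)%type.

Definition hsum_dot (x y : hsum E F) : C := dot x.1 y.1 + dot x.2 y.2.

Fact hsum_dotDZl a x y z :
  hsum_dot (a *: x + y) z = a * hsum_dot x z + hsum_dot y z.
Proof. by rewrite /hsum_dot /= !dotDZl; ring. Qed.

Fact hsum_dotC x y : hsum_dot y x = Num.conj (hsum_dot x y).
Proof. by rewrite /hsum_dot rmorphD /= -!dotC. Qed.

Fact hsum_dot_ge0 x : 0 <= hsum_dot x x.
Proof. by rewrite addr_ge0// dot_ge0. Qed.

Fact hsum_dot_eq0 x : hsum_dot x x = 0 -> x = 0.
Proof.
case: x => x y /eqP; rewrite /hsum_dot /= paddr_eq0 ?dot_ge0//.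
by move=> /andP[/eqP/dot_eq0 -> /eqP/dot_eq0 ->].
Qed.

HB.instance Definition _ := Lmodule_isInner.Build C (hsum E F)
  hsum_dotDZl hsum_dotC hsum_dot_ge0 hsum_dot_eq0.

Lemma hsum_normE (x : hsum E F) : `|x| ^+ 2 = `|x.1| ^+ 2 + `|x.2| ^+ 2.
Proof. by rewrite -!dotxx. Qed.

Lemma hsum_norm1 (x : hsum E F) : `|x.1| <= `|x|.
Proof.
rewrite -(@ler_pXn2r _ 2) ?nnegrE ?normr_ge0//.
by rewrite hsum_normE lerDl exprn_ge0.
Qed.

Lemma hsum_norm2 (x : hsum E F) : `|x.2| <= `|x|.
Proof.
rewrite -(@ler_pXn2r _ 2) ?nnegrE ?normr_ge0//.
by rewrite hsum_normE lerDr exprn_ge0.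
Qed.

Lemma hsum_norm_le (x : hsum E F) : `|x| <= `|x.1| + `|x.2|.
Proof.
rewrite -(@ler_pXn2r _ 2) ?nnegrE ?normr_ge0 ?addr_ge0 ?normr_ge0//.
by rewrite hsum_normE sqrrD lerD2r lerDl mulrn_wge0// mulr_ge0 ?normr_ge0.
Qed.

End hsum_inner.

Section hsum_complete.
Context (C : numClosedFieldType) (E F : hilbertType C).

Fact hsum_complete (G : set_system (hsum E F)) :
  ProperFilter G -> cauchy G -> cvg G.
Proof.
move=> GG /cauchyP Gc.
have /cvg_ex[a Ga] : cvg ((fun x : hsum E F => x.1) @ G).
  apply: cauchy_cvg; apply: cauchy_exP => e e0; have [x Gx] := Gc _ e0.
  exists x.1; change (G ((fun x : hsum E F => x.1) @^-1` ball x.1 e)).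
  apply: filterS Gx => y; rewrite /preimage -!ball_normE /=.
  by apply: le_lt_trans; exact: (hsum_norm1 (x - y)).
have /cvg_ex[b Gb] : cvg ((fun x : hsum E F => x.2) @ G).
  apply: cauchy_cvg; apply: cauchy_exP => e e0; have [x Gx] := Gc _ e0.
  exists x.2; change (G ((fun x : hsum E F => x.2) @^-1` ball x.2 e)).
  apply: filterS Gx => y; rewrite /preimage -!ball_normE /=.
  by apply: le_lt_trans; exact: (hsum_norm2 (x - y)).
apply/cvg_ex; exists ((a, b) : hsum E F); apply/cvgrPdist_lt => e e0.
have e20 : 0 < e / 2 by rewrite divr_gt0.
move/cvgrPdist_lt : Ga => /(_ _ e20) Ga; move/cvgrPdist_lt : Gb => /(_ _ e20) Gb.
near=> z; rewrite (le_lt_trans (hsum_norm_le _))// [e]splitr ltrD//=.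
  by near: z.
by near: z.
Unshelve. all: by end_near. Qed.

HB.instance Definition _ := Uniform_isComplete.Build (hsum E F) hsum_complete.

End hsum_complete.

Section hardy_operators.
Context (R : realType) (E : innerType R[i]).

Lemma square_summable_bounded (f : nat -> E) (M : R) :
  (forall N, series (normsq \o f) N <= M) -> f \in square_summable.
Proof.
move=> fM; apply/square_summableP; apply: nondecreasing_is_cvgn.
  apply/nondecreasing_seqP => n; rewrite !seriesEnat /= big_nat_recr//=.
  by rewrite lerDl normsq_ge0.
by exists M => _ [n _ <-].
Qed.

Definition shift_coef (f : nat -> E) (n : nat) : E :=
  if n is k.+1 then f k else 0.

Fact shift_coefP (f : hardy E) : shift_coef f \in square_summable.
Proof.
apply: (@square_summable_bounded _ (limn (series (normsq \o f)))) => -[|N].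
  by rewrite (le_trans _ (normsq_le_lim f 0))// /series /= !big_geq.
rewrite (le_trans _ (normsq_le_lim f N))// /series /= big_nat_recl//=.
by rewrite /normsq normr0 expr0n /= add0r.
Qed.

(* f(z) |-> z f(z) *)
Definition hshift (f : hardy E) : hardy E := Hardy (shift_coefP f).

Definition const_coef (e : E) (n : nat) : E := if n is 0%N then e else 0.

Fact const_coefP (e : E) : const_coef e \in square_summable.
Proof.
apply: (@square_summable_bounded _ (normsq e)) => -[|N].
  by rewrite /series /= big_geq// normsq_ge0.
rewrite /series /= big_nat_recl//= big1 ?addr0// => k _.
by rewrite /normsq normr0 expr0n.
Qed.

(* the constant function z |-> e *)
Definition hconst (e : E) : hardy E := Hardy (const_coefP e).

End hardy_operators.

Section hilbert_geometry.
Context (C : numClosedFieldType).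

Definition subspace (E : innerType C) (M : set E) : Prop :=
  M 0 /\ forall (a : C) x y, M x -> M y -> M (a *: x + y).

Definition orthogonal_sets (E : innerType C) (A B : set E) : Prop :=
  forall x y, A x -> B y -> dot x y = 0.

Definition orthocomplement (E : innerType C) (A : set E) : set E :=
  [set x | forall y, A y -> dot x y = 0].

Definition is_orthogonal_sum2 (E : innerType C) (M A B : set E) : Prop :=
  orthogonal_sets A B /\ M = [set x + y | x in A & y in B].

Definition is_orthogonal_sum3 (E : innerType C) (M A B D : set E) : Prop :=
  [/\ orthogonal_sets A B, orthogonal_sets A D, orthogonal_sets B D &
      M = [set x + y | x in [set x + y | x in A & y in B] & y in D]].

Definition line (E : innerType C) (v : E) : set E := range (fun a : C => a *: v).

(* A (+) B inside the external direct sum *)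
Definition dsum (E F : innerType C) (A : set E) (B : set F) : set (hsum E F) :=
  [set x | A x.1 /\ B x.2].

Definition separable (E : innerType C) : Prop :=
  exists2 D : set E, countable D & dense D.

Definition orthonormal_basis (E : innerType C) (B : set E) : Prop :=
  [/\ forall b, B b -> `|b| = 1,
      forall b b', B b -> B b' -> b <> b' -> dot b b' = 0 &
      orthocomplement B = [set 0]].

Definition same_dimension (E F : innerType C) : Prop :=
  exists (A : set E) (B : set F),
    [/\ orthonormal_basis A, orthonormal_basis B & (A #= B)%card].

Definition bounded_operator (E F : innerType C) (T : E -> F) : Prop :=
  linear T /\ exists K : C, forall x, `|T x| <= K * `|x|.

Definition closed_invariant_subspace (E : innerType C) (T : E -> E)
    (M : set E) : Prop :=
  [/\ subspace M, closed M & T @` M `<=` M].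

(* S|_M and T|_N are unitarily equivalent; only the values of U on M matter. *)
Definition unitarily_equivalent (E F : innerType C)
    (S : E -> E) (M : set E) (T : F -> F) (N : set F) : Prop :=
  exists U : E -> F,
    [/\ forall (a : C) x y, M x -> M y -> U (a *: x + y) = a *: U x + U y,
        U @` M = N,
        forall x y, M x -> M y -> dot (U x) (U y) = dot x y &
        forall x, M x -> U (S x) = T (U x)].

End hilbert_geometry.

Section hardy_functions.
Context (R : realType).
Notation C := R[i].

Definition disk : set C := [set z | `|z| < 1].

(* the value of f at a point of the disk *)
Definition heval (E : hilbertType C) (f : hardy E) (z : C) : E :=
  limn (series (fun n => z ^+ n *: f n)).

(* Psi represents an element of H^\infty(D; B(E, F)); only its values on the
   disk matter. The power series converges in operator norm. *)
Definition Hinfty (E F : hilbertType C) (Psi : C -> E -> F) : Prop :=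
  [/\ forall z, disk z -> linear (Psi z),
      exists K : C, forall z, disk z -> forall x, `|Psi z x| <= K * `|x| &
      exists2 A : nat -> E -> F, forall n, bounded_operator (A n) &
        forall z, disk z -> forall e : C, 0 < e ->
          \forall N \near \oo, forall x,
            `|Psi z x - \sum_(0 <= n < N) z ^+ n *: A n x| <= e * `|x|].

(* M_Psi f = h *)
Definition is_mulop (E F : hilbertType C) (Psi : C -> E -> F)
    (f : hardy E) (h : hardy F) : Prop :=
  forall z, disk z -> heval h z = Psi z (heval f z).

Definition inner_operator (E F : hilbertType C) (Psi : C -> E -> F) : Prop :=
  Hinfty Psi /\ forall f, exists2 h, is_mulop Psi f h & `|h| = `|f|.

Definition mulop_range (E F : hilbertType C) (Psi : C -> E -> F) :
  set (hardy F) := [set h | exists f, is_mulop Psi f h].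

Definition scalar_operator (phi : C -> C) (z : C) (x : C^o) : C^o := phi z * x.

Definition inner_function (phi : C -> C) : Prop :=
  inner_operator (scalar_operator phi).

End hardy_functions.

Notation H2 R := (hardy R[i]^o).

(* H^2(D^2) = H^2(D; H^2(D)): the outer variable is z_1, the inner one z_2, so
   F m n is the coefficient of z_1^m z_2^n. *)
Notation H2D2 R := (hardy (H2 R)).

Notation brownian_space R := (hsum (H2D2 R) (hsum (H2 R) R[i]^o)).

Section brownian_shift.
Context (R : realType).
Notation C := R[i].

Definition heval2 (F : H2D2 R) (z1 z2 : C) : C := heval (heval F z1) z2.

Definition expi (theta : R) : C := (cos theta +i* sin theta)%C.

(* For a one-variable f, hconst f : H^2(D^2) is f_{z_2}. *)
Definition brownian_shift (sigma theta : R) (x : brownian_space R) :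
    brownian_space R :=
  let: (F, (f, alpha)) := x in
  (hshift F + sigma%:C%C *: hconst f,
   (hshift f + sigma%:C%C *: hconst alpha, expi theta * alpha)).

Definition model_space (phi : C -> C) : set (H2 R) :=
  orthocomplement (mulop_range (scalar_operator phi)).

(* phi_{z_2} H^2(D^2) *)
Definition phi_z2_range (phi : C -> C) : set (H2D2 R) :=
  [set G | exists F : H2D2 R, forall z1 z2, disk z1 -> disk z2 ->
    heval2 G z1 z2 = phi z2 * heval2 F z1 z2].

(* g_{z_2} H^2_{z_1}(D) *)
Definition g_z2_range (g : H2 R) : set (H2D2 R) :=
  [set G | exists h : H2 R, forall z1 z2, disk z1 -> disk z2 ->
    heval2 G z1 z2 = heval g z2 * heval h z1].

Definition inner_into_model (phi : C -> C) (E : hilbertType C)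
    (Psi : C -> E -> H2 R) : Prop :=
  inner_operator Psi /\ forall z x, disk z -> model_space phi (Psi z x).

Definition lifted_typeI (E : hilbertType C)
    (M0 : set (H2D2 R)) (M1 : set (hsum (H2 R) C^o)) : Prop :=
  exists (phi : C -> C) (Psi : C -> E -> H2 R),
    [/\ inner_function phi,
        inner_into_model phi Psi,
        M1 = dsum (mulop_range (scalar_operator phi)) [set 0] &
        is_orthogonal_sum2 M0 (phi_z2_range phi) (mulop_range Psi)].

(* Radial limit at e^{i theta}; for a bounded analytic phi the nontangential
   limit exists, with the same value, as soon as the radial one does. *)
Definition boundary_value (phi : C -> C) (theta : R) (l : C) : Prop :=
  (fun r : R => phi (r%:C%C * expi theta) : C^o) @ 1^'- --> (l : C^o).

(* The difference quotient g, given as an element of H^2(D), so that its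
   existence includes the square-summability condition. *)
Definition is_brownian_g (sigma theta : R) (phi : C -> C) (g : H2 R) : Prop :=
  exists2 l : C, boundary_value phi theta l &
    forall z, disk z ->
      heval g z = sigma%:C%C * ((Num.conj l * phi z - 1) / (z - expi theta)).

Definition lifted_typeII_with (sigma theta : R) (E : hilbertType C)
    (M0 : set (H2D2 R)) (M1 : set (hsum (H2 R) C^o))
    (phi : C -> C) (g : H2 R) (Psi : C -> E -> H2 R) : Prop :=
  [/\ inner_function phi,
      is_brownian_g sigma theta phi g,
      inner_into_model phi Psi /\ (forall x, dot (Psi 0 x) g = 0),
      is_orthogonal_sum2 M1 (line ((g, 1) : hsum (H2 R) C^o))
        (dsum (mulop_range (scalar_operator phi)) [set 0]) &
      is_orthogonal_sum3 M0 (phi_z2_range phi) (g_z2_range g)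
        (mulop_range Psi)].

Definition lifted_typeII (sigma theta : R) (E : hilbertType C)
    (M0 : set (H2D2 R)) (M1 : set (hsum (H2 R) C^o)) : Prop :=
  exists phi g Psi, @lifted_typeII_with sigma theta E M0 M1 phi g Psi.

End brownian_shift.

(* Main.v *)
Require Import Defs.
From HB Require Import structures.
From mathcomp Require Import all_boot all_order all_algebra.
From mathcomp Require Import all_classical all_reals.
From mathcomp Require Import interval_inference topology normedtype sequences.
From mathcomp Require Import realfun trigo.
From mathcomp Require Import complex ring lra.

Import Order.TTheory GRing.Theory Num.Theory.
Import numFieldNormedType.Exports.

Local Open Scope classical_set_scope.
Local Open Scope ring_scope.

Set Implicit Arguments.
Unset Strict Implicit.
Unset Printing Implicit Defensive.

(** Write a vector of [M] as [(F, m)] with [F] in [M0] and [m = (f, alpha)] in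
[M1], and let [T1 (f, alpha) = (z f + sigma alpha, e^(i theta) alpha)], so that
[T (F, m) = (z_1 F + sigma f_(z_2), T1 m)].

Rigidity.  As [z_1 F] is orthogonal to every function of [z_2] alone and [z f]
to the constants,
[|T (F, m)|^2 - |(F, m)|^2 = sigma^2 |m|^2].  An intertwining unitary therefore
preserves [sigma |m|], hence carries [M0] onto [N0] and [M1] onto [N1]
([unitarily_equivalent_split]); since [M1] contains the nonzero space
[phi H^2], the two values of [sigma] agree.  The same identity one level down,
[|T1 m|^2 - |m|^2 = sigma^2 |alpha|^2], shows that [|alpha|] is preserved, which
separates the two types.  In Type II the vector [v = (g, 1)] spans the
orthocomplement of [phi H^2] in [M1], so it goes to a unimodular multiple of its
counterpart; [|v|^2 = |g|^2 + 1] and [<T1 v, v> = e^(i theta) |v|^2] then give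
[|g|] and [theta].  The multiplicity space is recovered from [M0]: evaluating
[U T = T U] at [(0, m)] shows that if [U] maps [(f, alpha)] to [(f', alpha')]
then it maps [f_(z_2)] to [f'_(z_2)], while [Psi H^2(E)] consists of the [x] in
[M0] all of whose [z_1]-coefficients are orthogonal to the first components of
[M1] ([model_range]).  So [U] carries one space [Psi H^2(E)] onto the other and
commutes with the shift there; it thus maps wandering subspace onto wandering
subspace, and these are copies of [E_M] and [E_N] ([wandering_unitary]).

Sufficiency.  [M] is the isometric image of coordinates [(F, h, k, f, alpha)]
([assemble]).  In these coordinates neither the inner product
([dot_assemble]) nor the action of [T] ([brownian_shift_assemble]) sees [phi] or
[Psi]: only [sigma], [theta], [|g|] and the boundary value [l] of [phi] occur,
and a rotation of [F] and [f] removes [l] because [|l| = 1], as one sees by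
computing [|T1 (g, 1)|] in two ways ([brownian_g_unimodular]).  Matching the coordinate [k] requires a unitary
[E_M -> E_N], obtained from a bijection of orthonormal bases by extending to the
closed span ([closure_rel_total]). *)

(** * Isometries and orthonormal bases of inner product spaces *)

Section geometry.
Context (C : numClosedFieldType).
Implicit Types E F : innerType C.

Lemma dotNl E (x y : E) : dot (- x) y = - dot x y.
Proof. by rewrite -scaleN1r dotZl mulN1r. Qed.

Lemma dotNr E (x y : E) : dot x (- y) = - dot x y.
Proof. by rewrite -scaleN1r dotZr rmorphN1 mulN1r. Qed.

Lemma dotBl E (x y z : E) : dot (x - y) z = dot x z - dot y z.
Proof. by rewrite dotDl dotNl. Qed.

Lemma dotBr E (x y z : E) : dot z (x - y) = dot z x - dot z y.
Proof. by rewrite dotDr dotNr. Qed.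

Lemma dot0r E (x : E) : dot x 0 = 0.
Proof. by rewrite dotC dot0l conjC0. Qed.

Lemma dot_sym0 E (x y : E) : dot x y = 0 -> dot y x = 0.
Proof. by move=> xy; rewrite dotC xy conjC0. Qed.

Lemma dotxx_inj E F (x : E) (y : F) : dot x x = dot y y <-> `|x| = `|y|.
Proof.
rewrite !dotxx; split => [/eqP|->//].
by rewrite eqrXn2 ?normr_ge0// => /eqP.
Qed.

Lemma polarization E (x y : E) :
  dot x y *+ 2 = (dot (x + y) (x + y) - dot x x - dot y y)
    + 'i * (dot (x + 'i *: y) (x + 'i *: y) - dot x x - dot y y).
Proof.
rewrite !dotDl !dotDr !dotZl !dotZr conjCi.
have ii : 'i * 'i = -1 :> C by rewrite -expr2 sqrCi.
rewrite (_ : _ + _ = dot x y *+ 2 + (1 + 'i * 'i) * (dot y x - dot x y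
  - 'i * dot y y)); last by ring.
by rewrite ii subrr mul0r addr0.
Qed.

Lemma isometry_dot E F (J : E -> F) : linear J -> (forall x, `|J x| = `|x|) ->
  forall x y, dot (J x) (J y) = dot x y.
Proof.
move=> Jlin Jn x y.
have d0 z : dot (J z) (J z) = dot z z by apply/dotxx_inj.
have JD u v : J (u + v) = J u + J v by rewrite -[u]scale1r Jlin !scale1r.
have J0 : J 0 = 0 by apply: (addrI (J 0)); rewrite -JD !addr0.
have JZ a v : J (a *: v) = a *: J v by rewrite -[a *: v]addr0 Jlin J0 addr0.
apply: (@pmulrnI _ 2) => //.
by rewrite !polarization -!JZ -!JD !d0.
Qed.

(** Two families with the same Gram matrix differ by an isometry of their ranges:
any linear relation among the vectors of one family is read off from inner
products, so it holds for the other. This makes [U : P x |-> Q x] well defined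
and linear with no linear structure on the index type. *)
Lemma unitarily_equivalent_gram E F (S : E -> E) (M : set E) (T : F -> F)
    (N : set F) (X : Type) (P : X -> E) (Q : X -> F) :
  Defs.subspace M -> M = range P -> N = range Q ->
  (forall x y, dot (P x) (P y) = dot (Q x) (Q y)) ->
  (forall x, exists2 x', S (P x) = P x' & T (Q x) = Q x') ->
  unitarily_equivalent S M T N.
Proof.
move=> [_ Mlin] MP NQ PQ ST.
have Qlin a x y w : P w = a *: P x + P y -> Q w = a *: Q x + Q y.
  move=> /eqP; rewrite -subr_eq0 => /eqP Pw.
  apply/eqP; rewrite -subr_eq0; apply/eqP/dot_eq0.
  transitivity (dot (P w - (a *: P x + P y)) (P w - (a *: P x + P y))).
    by rewrite !dotBl !dotBr !dotDl !dotDr !dotZl !dotZr !PQ.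
  by rewrite Pw dot0l.
pose U e := if pselect (exists x, P x = e) is left h then Q (projT1 (cid h))
  else 0.
have UP x : U (P x) = Q x.
  rewrite /U; case: pselect => [h|[]]; last by exists x.
  case: cid => y /= Pyx.
  have /Qlin -> : P y = 0 *: P x + P x by rewrite scale0r add0r.
  by rewrite scale0r add0r.
exists U; split.
- move=> a x y Mx My; have := Mlin a _ _ Mx My.
  move: Mx My; rewrite MP => -[x' _ <-] [y' _ <-] [w _ Pw].
  by rewrite -Pw !UP; exact: Qlin.
- rewrite MP NQ; apply/seteqP; split => [_ [_ [x _ <-] <-]|_ [x _ <-]].
    by exists x; rewrite ?UP.
  by exists (P x); rewrite ?UP//; exists x.
- by move=> x y; rewrite MP => -[x' _ <-] [y' _ <-]; rewrite !UP PQ.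
- move=> x; rewrite MP => -[x' _ <-]; rewrite UP.
  by have [w -> ->] := ST x'; rewrite UP.
Qed.

(** By Zorn's lemma: an orthonormal set that is maximal is total, for a nonzero
vector orthogonal to it could be normalized and added. *)
Lemma exists_orthonormal_basis E : exists A : set E, orthonormal_basis A.
Proof.
pose P (B : set E) := (forall b, B b -> `|b| = 1) /\
  (forall b b', B b -> B b' -> b <> b' -> dot b b' = 0).
have [|A [[A1 AO] Amax]] := @Zorn_bigcup E P.
  move=> F FP Ftot; split => [b [X FX Xb]|b b' [X FX Xb] [Y FY Yb']].
    by have [+ _] := FP _ FX; apply.
  have [XY|YX] := Ftot X Y FX FY.
    by have [_] := FP _ FY; apply => //; exact: XY.
  by have [_] := FP _ FX; apply => //; exact: YX.
exists A; split => //; apply/seteqP; split => [x /= xA|_ -> y _]; last first.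
  by rewrite dot0l.
apply/eqP; apply: contrapT => /negP x0.
have nx0 : `|x| != 0 by rewrite normr_eq0.
pose e := `|x|^-1 *: x.
have eA a : A a -> dot e a = 0 by move=> Aa; rewrite dotZl xA// mulr0.
have ne : `|e| = 1 by rewrite normrZ normfV normr_id mulVf.
have Ae : ~ A e.
  move=> /eA; rewrite dotxx ne expr1n => /eqP; by rewrite oner_eq0.
apply: (Amax (A `|` [set e])).
  split; first by move=> y Ay; left.
  by move=> /(_ e) h; apply: Ae; apply: h; right.
split => [b [/A1//|-> //]|b b' [Ab|->] [Ab'|->] //].
- exact: AO.
- by move=> _; apply: dot_sym0; exact: eA.
- by move=> _; exact: eA.
Qed.

Lemma same_dimension_unitary E F (W : E -> F) :
  (forall x y, dot (W x) (W y) = dot x y) -> (forall y, exists x, W x = y) ->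
  same_dimension E F.
Proof.
move=> Wd Wsurj; have [A [A1 AO AC]] := exists_orthonormal_basis E.
have nW x : `|W x| = `|x| by apply/dotxx_inj; exact: Wd.
have Winj : injective W.
  move=> x y Wxy; apply/eqP; rewrite -subr_eq0; apply/eqP/dot_eq0.
  by rewrite !dotBl !dotBr -!Wd Wxy; ring.
exists A, (W @` A); split => //; last first.
  by rewrite card_eq_sym; apply: inj_card_eq => x y _ _ /Winj.
split => [_ [x Ax <-]|_ _ [x Ax <-] [y Ay <-] xy|]; first by rewrite nW A1.
  by rewrite Wd AO// => /(congr1 W).
apply/seteqP; split => [y /= yA|_ -> y _]; last by rewrite dot0l.
have [x xy] := Wsurj y.
have : orthocomplement A x by move=> a Aa; rewrite -Wd xy yA//; exists a.
rewrite AC /= => x0.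
by apply: dot_eq0; rewrite -xy Wd x0 dot0l.
Qed.

End geometry.

(** * Power series in Hilbert spaces *)

Section dominated_series.
Context (R : realType).

Lemma cvg_series_dominated (E : hilbertType R[i]) (u : nat -> E) (r : nat -> R) :
  (forall n, `|u n| <= (r n)%:C%C) -> cvgn (series r) -> cvgn (series u).
Proof.
move=> ur /cauchy_cvgP/cauchy_seriesP rc.
apply/cauchy_cvgP/cauchy_seriesP => _ /complex_pos[d d0 ->].
apply: filterS (rc _ d0) => n /= nd.
rewrite (le_lt_trans (ler_norm_sum _ _ _))//.
apply: (@le_lt_trans _ _ (\sum_(n.1 <= k < n.2) r k)%:C%C).
  by rewrite rmorph_sum /= ler_sum// => k _; exact: ur.
by rewrite ltcR (le_lt_trans (ler_norm _) nd).
Qed.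

Lemma norm_series_dominated (E : hilbertType R[i]) (u : nat -> E) (r : nat -> R)
    (B : R) :
  (forall n, `|u n| <= (r n)%:C%C) -> cvgn (series r) ->
  (forall n, series r n <= B) -> `|limn (series u)| <= B%:C%C.
Proof.
move=> ur cr rB; have /cvgrPdist_lt cu := cvg_series_dominated ur cr.
apply/ler_addgt0Pr => e e0.
have [N _ /(_ N (leqnn _)) uN] := cu e e0.
rewrite -[limn (series u)](subrK (series u N)) (le_trans (ler_normD _ _))//.
rewrite addrC lerD ?(ltW uN)// (@le_trans _ _ (series r N)%:C%C) ?lecR//.
rewrite /series /= (le_trans (ler_norm_sum _ _ _))// rmorph_sum /=.
by rewrite ler_sum// => k _; exact: ur.
Qed.

Lemma lim_series_recl (E : hilbertType R[i]) (u : nat -> E) :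
  cvgn (series (fun n => u n.+1)) ->
  limn (series u) = u 0%N + limn (series (fun n => u n.+1)).
Proof.
move=> cu; apply: cvg_lim => //; rewrite -cvg_shiftS.
rewrite (_ : [sequence _]_n = cst (u 0%N) + series (fun n => u n.+1)).
  by apply: cvgD => //; exact: cvg_cst.
by apply/funext => n; rewrite !fctE /series /= big_nat_recl.
Qed.

End dominated_series.

Section hardy_dot.
Context (R : realType).
Implicit Types E F : innerType R[i].

Fact bshift_coefP E (f : hardy E) : (fun n => f n.+1) \in square_summable.
Proof.
apply: (@square_summable_bounded _ _ _ (limn (series (normsq \o f)))) => N.
rewrite (le_trans _ (normsq_le_lim f N.+1))// /series /= big_nat_recl//=.
by rewrite lerDr normsq_ge0.
Qed.

(** The backward shift [f |-> (f - f(0)) / z], adjoint of [hshift]. *)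
Definition bshift E (f : hardy E) : hardy E := Hardy (bshift_coefP f).

Lemma bshift_hshift E (f : hardy E) : bshift (hshift f) = f.
Proof. exact: hardyP. Qed.

Lemma bshift_hconst E (e : E) : bshift (hconst e) = 0.
Proof. exact: hardyP. Qed.

Lemma hconst0 E : hconst (0 : E) = 0.
Proof. by apply: hardyP => -[]. Qed.

Lemma hardy_split E (f : hardy E) : f = hconst (f 0%N) + hshift (bshift f).
Proof. by apply: hardyP => -[|n]; rewrite hardyDE /= ?addr0 ?add0r. Qed.

Lemma dot_split E (f g : hardy E) :
  dot f g = dot (f 0%N) (g 0%N) + dot (bshift f) (bshift g).
Proof.
have cv := @is_cvg_hardy_dot _ _ (bshift f) (bshift g).
exact: (@lim_series_recl R R[i]^o (fun n => dot (f n) (g n)) cv).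
Qed.

Lemma dot_hconstr E (f : hardy E) e : dot f (hconst e) = dot (f 0%N) e.
Proof. by rewrite dot_split bshift_hconst dot0r addr0. Qed.

Lemma dot_hshiftr E (f g : hardy E) : dot f (hshift g) = dot (bshift f) g.
Proof. by rewrite dot_split bshift_hshift dot0r add0r. Qed.

Lemma dot_hconst E (e e' : E) : dot (hconst e) (hconst e') = dot e e'.
Proof. by rewrite dot_hconstr. Qed.

Lemma dot_hshift E (f g : hardy E) : dot (hshift f) (hshift g) = dot f g.
Proof. by rewrite dot_hshiftr bshift_hshift. Qed.

Lemma dot_hconst_hshift E (e : E) f : dot (hconst e) (hshift f) = 0.
Proof. by rewrite dot_hshiftr bshift_hconst dot0l. Qed.

(** The monomial [z^n e]. *)
Definition hmonom E (n : nat) (e : E) : hardy E := iter n (@hshift R E) (hconst e).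

Lemma dot_hmonomr E (f : hardy E) n e : dot f (hmonom n e) = dot (f n) e.
Proof.
elim: n f => [|n IHn] f; first exact: dot_hconstr.
by rewrite /hmonom iterS dot_hshiftr IHn.
Qed.

Lemma hmonomE E n (e : E) k : hmonom n e k = if k == n then e else 0.
Proof. by elim: n k => [|n IHn] [|k] //=; exact: IHn. Qed.

Lemma hshiftZD E a (f g : hardy E) : hshift (a *: f + g) = a *: hshift f + hshift g.
Proof. by apply: hardyP => -[|n]; rewrite hardyDE hardyZE /= ?scaler0 ?addr0. Qed.

Lemma hshiftD E (f g : hardy E) : hshift (f + g) = hshift f + hshift g.
Proof. by rewrite -[f in LHS]scale1r hshiftZD scale1r. Qed.

Lemma hshiftZ E a (f : hardy E) : hshift (a *: f) = a *: hshift f.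
Proof. by apply: hardyP => -[|n]; rewrite hardyZE /= ?scaler0. Qed.

Lemma hconstD E (e e' : E) : hconst (e + e') = hconst e + hconst e'.
Proof. by apply: hardyP => -[|n]; rewrite hardyDE /= ?addr0. Qed.

Lemma hconstZ E a (e : E) : hconst (a *: e) = a *: hconst e.
Proof. by apply: hardyP => -[|n]; rewrite hardyZE /= ?scaler0. Qed.

End hardy_dot.

Section coefficientwise.
Context (R : realType).

(** The scalar [c] lets one notion cover isometries ([c = 1]) and the maps
[a |-> a g] ([c = |g|^2]), including [g = 0]. *)
Definition similarity (E F : innerType R[i]) (c : R[i]) (J : E -> F) : Prop :=
  linear J /\ forall x y, dot (J x) (J y) = c * dot x y.

Context (E F : innerType R[i]) (c : R[i]) (J : E -> F) (Jc : similarity c J).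

Lemma similarity0 : J 0 = 0.
Proof. by apply: dot_eq0; rewrite Jc.2 dot0l mulr0. Qed.

Lemma similarityD x y : J (x + y) = J x + J y.
Proof. by rewrite -[x in LHS]scale1r Jc.1 scale1r. Qed.

Lemma similarityZ a x : J (a *: x) = a *: J x.
Proof. by rewrite -[a *: x]addr0 Jc.1 similarity0 addr0. Qed.

Fact hmap_coefP (f : hardy E) : (fun n => J (f n)) \in square_summable.
Proof.
apply/square_summableP.
rewrite (_ : _ \o _ = complex.Re c *: (normsq \o f)).
  by apply: is_cvg_seriesZ; exact: cvg_normsq.
apply/funext => n; rewrite fctE /= {1}/normsq -dotxx Jc.2 dotxx -normsqE.
by case: c => a b; rewrite /GRing.scale /= mulr0 subr0.
Qed.

(** [J] composed with the [E]-valued function [f]; on coefficients this is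
[J] coefficientwise because [J] is linear and bounded ([heval_hmap]). *)
Definition hmap (f : hardy E) : hardy F := Hardy (hmap_coefP f).

Lemma hmapE f n : hmap f n = J (f n). Proof. by []. Qed.

Lemma hmap_similarity : similarity c hmap.
Proof.
split=> [a f g|f g]; first by apply: hardyP => n; rewrite !hmapE Jc.1.
apply: (@cvg_lim R[i]^o) => //.
rewrite (_ : series _ = c *: series (fun n => dot (f n) (g n) : R[i]^o)).
  by apply: cvgZl_tmp; exact: is_cvg_hardy_dot.
apply/funext => n; rewrite fctE /series /= scaler_sumr.
by apply: eq_bigr => k _; rewrite Jc.2.
Qed.

Lemma hmap_hshift f : hmap (hshift f) = hshift (hmap f).
Proof. by apply: hardyP => -[|n] //=; exact: similarity0. Qed.

End coefficientwise.

Section hardy_eval.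
Context (R : realType).
Implicit Types E F : hilbertType R[i].

Lemma complex_norm_real (z : R[i]) : exists2 r : R, 0 <= r & `|z| = r%:C%C.
Proof.
exists (complex.Re `|z|); last by rewrite RRe_real// normr_real.
by rewrite -lecR RRe_real ?normr_real// normr_ge0.
Qed.

Lemma is_cvg_heval E (f : hardy E) (z : R[i]) :
  disk z -> cvgn (series (fun n => z ^+ n *: f n)).
Proof.
rewrite /disk /=; have [r r0 zr] := complex_norm_real z.
rewrite zr ltcR => r1; have [K K0 fK] := complex_norm_real `|f|.
have {}fK n : `|f n| <= K%:C%C by rewrite -fK normr_id hardy_norm_coef.
apply: (@cvg_series_dominated _ _ _ (geometric K r)) => [n|].
  rewrite normrZ normrX zr /geometric /= rmorphM rmorphXn /= mulrC.
  by rewrite ler_pM// exprn_ge0// lecR.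
by apply: is_cvg_geometric_series; rewrite ger0_norm.
Qed.

Arguments is_cvg_heval {E} f {z} _.

Lemma heval_split E (f : hardy E) z : disk z ->
  heval f z = f 0%N + z *: heval (bshift f) z.
Proof.
move=> zD; have cf := is_cvg_heval (bshift f) zD.
have E1 : series (fun n => z ^+ n.+1 *: f n.+1) =
    z *: series (fun n => z ^+ n *: bshift f n).
  apply/funext => n; rewrite fctE /series /= scaler_sumr.
  by apply: eq_bigr => k _; rewrite scalerA exprS.
have cE : series (fun n => z ^+ n.+1 *: f n.+1) @ \oo -->
    z *: heval (bshift f) z by rewrite E1; apply: cvgZl_tmp.
rewrite {1}/heval lim_series_recl; last by apply/cvg_ex; eexists; exact: cE.
by rewrite expr0 scale1r (cvg_lim _ cE).
Qed.

Lemma hevalZD E a (f g : hardy E) z : disk z ->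
  heval (a *: f + g) z = a *: heval f z + heval g z.
Proof.
move=> zD; apply: cvg_lim => //.
rewrite (_ : series _ = a *: series (fun n => z ^+ n *: f n) +
                        series (fun n => z ^+ n *: g n)).
  by apply: cvgD; [apply: cvgZl_tmp|]; exact: is_cvg_heval.
apply/funext => n; rewrite !fctE /series /= scaler_sumr -big_split /=.
by apply: eq_bigr => k _; rewrite scalerDr !scalerA mulrC.
Qed.

Lemma heval0 E z : disk z -> heval (0 : hardy E) z = 0.
Proof.
move=> zD; have /eqP := hevalZD 1 (0 : hardy E) 0 zD.
by rewrite !scale1r addr0 -subr_eq0 opprD addNKr oppr_eq0 => /eqP.
Qed.

Lemma hevalD E (f g : hardy E) z : disk z ->
  heval (f + g) z = heval f z + heval g z.
Proof. by move=> zD; rewrite -{1}[f]scale1r hevalZD// scale1r. Qed.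

Lemma hevalZ E a (f : hardy E) z : disk z -> heval (a *: f) z = a *: heval f z.
Proof. by move=> zD; rewrite -[a *: f]addr0 hevalZD// heval0// addr0. Qed.

Lemma heval_hshift E (f : hardy E) z : disk z ->
  heval (hshift f) z = z *: heval f z.
Proof. by move=> zD; rewrite heval_split// bshift_hshift add0r. Qed.

Lemma heval_hconst E (e : E) z : disk z -> heval (hconst e) z = e.
Proof. by move=> zD; rewrite heval_split// bshift_hconst heval0// scaler0 addr0. Qed.

(** Bounds the remainder in [f(z) = f(0) + z (bshift f)(z)], which makes [heval f]
continuous at 0. *)
Lemma norm_heval_half E (f : hardy E) z : `|z| <= 2^-1 ->
  `|heval f z| <= `|f| * 2.
Proof.
have [r r0 zr] := complex_norm_real z.
have h2 : (2^-1)%:C%C = 2^-1 :> R[i] by rewrite fmorphV rmorph_nat.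
rewrite zr -h2 lecR => r1; have [K K0 fK] := complex_norm_real `|f|.
rewrite normr_id in fK.
have fKn n : `|f n| <= K%:C%C by rewrite -fK hardy_norm_coef.
have hc : cvgn (series (geometric K (2^-1 : R))).
  by apply: is_cvg_geometric_series; rewrite ger0_norm ?invr_ge0// invf_lt1// ltr1n.
rewrite fK -[2](rmorph_nat (@real_complex R)) -rmorphM.
apply: (norm_series_dominated _ hc) => n.
  rewrite normrZ normrX zr /geometric /= rmorphM rmorphXn /= mulrC.
  rewrite ler_pM// ?exprn_ge0// ?lecR// -!rmorphXn lecR.
  by rewrite lerXn2r ?nnegrE// invr_ge0.
have h : (2^-1 : R) != 1 by rewrite lt_eqF// invf_lt1 ?ltr1n.
rewrite geometric_seriesE//=.
have -> : (1 - 2^-1 : R) = 2^-1 by field.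
rewrite invrK ler_pM2r// ler_piMr// gerBl exprn_ge0 ?invr_ge0//.
Qed.

(** Identity theorem. Only the punctured disk is assumed so that the statement
is inherited by [(f - f(0)) / z], which gives the coefficients one by one. *)
Lemma heval_punctured E (f : hardy E) :
  (forall z, disk z -> z != 0 -> heval f z = 0) -> f = 0.
Proof.
have base (g : hardy E) :
    (forall z, disk z -> z != 0 -> heval g z = 0) -> g 0%N = 0.
  move=> g0; apply/eqP/negPn/negP => ng0.
  set a := `|g 0%N|; have a0 : 0 < a by rewrite normr_gt0.
  set K := `|bshift g| * 2 + 1.
  have K1 : 1 <= K by rewrite lerDr mulr_ge0.
  have K0 : 0 < K by rewrite (lt_le_trans _ K1).
  have a10 : 0 < 1 + a by rewrite addr_gt0.
  (* A point so close to 0 that [|z (bshift g)(z)| <= |z| K < a]; dividing by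
     [1 + a] also keeps it in the disk of radius 1/2. *)
  pose z := a / (1 + a) / K / 2.
  have z0 : 0 < z by rewrite !divr_gt0.
  have zh : `|z| <= 2^-1.
    rewrite gtr0_norm// ler_piMl ?invr_ge0//.
    rewrite ler_pdivrMr// mul1r (le_trans _ K1)// ler_pdivrMr// mul1r.
    by rewrite lerDr.
  have zD : disk z by rewrite /disk /= (le_lt_trans zh)// invf_lt1 ?ltr1n.
  have := heval_split g zD; rewrite g0// ?gt_eqF// => /esym/eqP.
  rewrite addr_eq0 => /eqP/(congr1 Num.norm); rewrite normrN -/a normrZ => aE.
  have : a < a.
    rewrite {1}aE gtr0_norm// (@le_lt_trans _ _ (z * K))//.
      rewrite ler_pM2l// (le_trans (norm_heval_half _ zh))//.
      by rewrite lerDl.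
    rewrite /z -!mulrA (mulrCA K^-1) mulVf ?gt_eqF// mulr1.
    rewrite gtr_pMr// -invfM invf_lt1 ?mulr_gt0//.
    by rewrite mulrDl mul1r ltr_wpDr ?ltr1n// mulr_ge0// ltW.
  by rewrite ltxx.
move=> f0; suff H n : forall g : hardy E,
    (forall z, disk z -> z != 0 -> heval g z = 0) -> g n = 0.
  by apply: hardyP => n; rewrite (H n f f0).
elim: n => [|n IHn] g g0; first exact: base.
apply: (IHn (bshift g)) => z zD z0; have := heval_split g zD.
rewrite (base _ g0) g0// add0r => /esym/eqP; rewrite scaler_eq0 (negbTE z0) /=.
by move/eqP.
Qed.

Lemma heval_inj E (f g : hardy E) :
  (forall z, disk z -> heval f z = heval g z) -> f = g.
Proof.
move=> fg; apply/eqP; rewrite -subr_eq0; apply/eqP/heval_punctured => z zD _.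
by rewrite -scaleN1r hevalD// hevalZ// fg// scaleN1r subrr.
Qed.

End hardy_eval.

Section similarity_eval.
Context (R : realType) (E F : hilbertType R[i]) (c : R[i]) (J : E -> F)
  (Jc : similarity c J).

Lemma similarity_cvg (T : Type) (G : set_system T) (FG : Filter G)
  (u : T -> E) (l : E) : u @ G --> l -> J \o u @ G --> J l.
Proof.
move=> ul; apply/cvgrPdist_lt => e e0.
have K0 : 0 < `|c| + 1 by rewrite ltr_wpDl.
have JK x : `|J x| <= (`|c| + 1) * `|x|.
  rewrite -(@ler_pXn2r _ 2) ?nnegrE ?mulr_ge0 ?(ltW K0)//.
  rewrite exprMn -dotxx Jc.2 dotxx.
  have : 0 <= c * `|x| ^+ 2 by rewrite -dotxx -Jc.2 dot_ge0.
  move=> /ger0_norm <-; rewrite normrM [X in _ * X]ger0_norm ?exprn_ge0//.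
  rewrite ler_wpM2r ?exprn_ge0// -subr_ge0.
  rewrite [X in 0 <= X](_ : _ = `|c| ^+ 2 + `|c| + 1); last by ring.
  by rewrite !addr_ge0// exprn_ge0.
move/cvgrPdist_lt : ul => /(_ (e / (`|c| + 1)) (divr_gt0 e0 K0)).
apply: filterS => t lt.
rewrite -[- _]scaleN1r -(similarityZ Jc) -(similarityD Jc) scaleN1r.
by rewrite (le_lt_trans (JK _))// mulrC -ltr_pdivlMr.
Qed.

Lemma heval_hmap f z : disk z -> heval (hmap Jc f) z = J (heval f z).
Proof.
move=> zD; apply: cvg_lim => //.
rewrite (_ : series _ = J \o series (fun n => z ^+ n *: f n)).
  by apply: similarity_cvg; exact: is_cvg_heval.
apply/funext => n; rewrite /series /= (big_morph J (similarityD Jc) (similarity0 Jc)).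
by apply: eq_bigr => k _; rewrite (similarityZ Jc).
Qed.

End similarity_eval.

(** * Multiplication by an inner function as an isometry *)

Section mulop.
Context (R : realType) (E F : hilbertType R[i]) (Psi : R[i] -> E -> F)
  (Psi_inner : inner_operator Psi).

Definition mulop (f : hardy E) : hardy F := projT1 (cid2 (Psi_inner.2 f)).

Lemma heval_mulop f z : disk z -> heval (mulop f) z = Psi z (heval f z).
Proof. by rewrite /mulop; case: cid2 => h /= + _; apply. Qed.

Lemma is_mulop_unique f h : is_mulop Psi f h -> h = mulop f.
Proof. by move=> fh; apply: heval_inj => z zD; rewrite heval_mulop ?fh. Qed.

Lemma mulop_rangeE : mulop_range Psi = range mulop.
Proof.
apply/seteqP; split => [h [f /is_mulop_unique ->]|_ [f _ <-]]; exists f => //.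
by move=> z zD; rewrite heval_mulop.
Qed.

Lemma mulop_similarity : similarity 1 mulop.
Proof.
have [[Plin _ _] _] := Psi_inner.
have mlin : linear mulop.
  move=> a f g; apply: heval_inj => z zD.
  by rewrite hevalZD// !heval_mulop// hevalZD// Plin.
split => // x y; rewrite mul1r; apply: isometry_dot => // f.
by rewrite /mulop; case: cid2.
Qed.

Lemma mulop_hshift f : mulop (hshift f) = hshift (mulop f).
Proof.
have [[Plin _ _] _] := Psi_inner.
have PZ z a x : disk z -> Psi z (a *: x) = a *: Psi z x.
  move=> zD; have P0 : Psi z 0 = 0.
    by apply: (addrI (Psi z 0)); rewrite -[X in X + _]scale1r -Plin// scaler0 !addr0.
  by rewrite -[a *: x]addr0 Plin// P0 addr0.
by apply: heval_inj => z zD; rewrite heval_mulop// !heval_hshift// heval_mulop// PZ.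
Qed.

Lemma mulop_map : exists K : hardy E -> hardy F,
  [/\ similarity 1 K, forall k, K (hshift k) = hshift (K k) &
      mulop_range Psi = range K].
Proof.
exists mulop; split; first exact: mulop_similarity.
- exact: mulop_hshift.
- exact: mulop_rangeE.
Qed.

End mulop.

(** * Unitaries from correspondences between total sets *)

Section total_correspondence.
Context (R : realType) (E F : hilbertType R[i]).

(** The rate in the hypothesis is the one that the parallelogram law gives for
points whose squared distance to [x] is within [1/(n+1)] of the infimum. *)
Lemma cvgn_normsq (G : hilbertType R[i]) (w : nat -> G) :
  (forall n m, (n <= m)%N -> normsq (w n - w m) <= 4 * n.+1%:R^-1) -> cvgn w.
Proof.
move=> wP; apply: cauchy_cvg; apply: cauchy_exP => _ /complex_pos[d d0 ->].
have d40 : 0 < d ^+ 2 / 4 by rewrite divr_gt0// exprn_gt0.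
have [N _ /(_ N (leqnn _))/= NP] := near_infty_natSinv_lt (PosNum d40).
exists (w N); change (\forall n \near \oo, ball (w N) d%:C%C (w n)).
exists N => // n /= Nn; rewrite -ball_normE /=.
rewrite -(@ltr_pXn2r _ 2) ?nnegrE ?lecR ?(ltW d0)//.
rewrite -normsqE -rmorphXn /= ltcR (le_lt_trans (wP _ _ Nn))//.
by rewrite mulrC -ltr_pdivlMr.
Qed.

Lemma normsqBZ (G : hilbertType R[i]) (w a : G) : `|a| = 1 ->
  (normsq (w - dot w a *: a))%:C%C = (normsq w)%:C%C - `|dot w a| ^+ 2.
Proof.
move=> a1; rewrite !normsqE -!dotxx dotBl !dotBr !dotZl !dotZr.
by rewrite dotxx [dot a a]dotxx a1 (dotC w a) -dotC normCK -dotC; ring.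
Qed.

Lemma parallelogram (G : hilbertType R[i]) (x u v : G) :
  normsq (u - v) = 2 * normsq (x - u) + 2 * normsq (x - v)
    - 4 * normsq (x - 2^-1 *: (u + v)).
Proof.
apply: (@complexI R).
rewrite !(rmorphB, rmorphD, rmorphM, rmorph_nat) /= !normsqE -!dotxx.
rewrite !(dotBl, dotBr, dotZl, dotZr, dotDl, dotDr) fmorphV rmorph_nat.
by field.
Qed.

(** The linear span of the graph of [P], kept as a relation: [P] need not be a
function, and the two spaces play symmetric roles. *)
Inductive span_rel (P : E -> F -> Prop) : E -> F -> Prop :=
| span_rel0 : span_rel P 0 0
| span_relD c a b x y : P a b -> span_rel P x y ->
    span_rel P (c *: a + x) (c *: b + y).

Lemma span_rel_linear P (t : R[i]) x y x' y' : span_rel P x y -> span_rel P x' y' ->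
  span_rel P (t *: x + x') (t *: y + y').
Proof.
move=> + h'; elim=> [|c a b u v Pab _ IH]; first by rewrite !scaler0 !add0r.
by rewrite !scalerDr !scalerA -!addrA; exact: span_relD.
Qed.

Definition gram_rel (P : E -> F -> Prop) : Prop :=
  forall a b a' b', P a b -> P a' b' -> dot a a' = dot b b'.

Lemma span_rel_dot P : gram_rel P -> gram_rel (span_rel P).
Proof.
move=> PP x y x' y' xy x'y'; elim: xy => [|c a b u v Pab _ IH].
  by rewrite !dot0l.
rewrite !dotDl !dotZl IH; congr (_ * _ + _).
elim: x'y' => [|c' a' b' u' v' Pab' _ IH']; first by rewrite !dot0r.
by rewrite !dotDr !dotZr IH' (PP _ _ _ _ Pab Pab').
Qed.

Definition closure_rel (P : E -> F -> Prop) (x : E) (y : F) : Prop :=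
  exists (u : nat -> E) (v : nat -> F),
    [/\ forall n, span_rel P (u n) (v n), u @ \oo --> x & v @ \oo --> y].

Lemma closure_rel_linear P (t : R[i]) x y x' y' :
  closure_rel P x y -> closure_rel P x' y' ->
  closure_rel P (t *: x + x') (t *: y + y').
Proof.
move=> [u [v [uv ux vy]]] [u' [v' [uv' ux' vy']]].
exists (t *: u + u'), (t *: v + v'); split.
- by move=> n; exact: span_rel_linear.
- by apply: cvgD => //; apply: cvgZl_tmp.
- by apply: cvgD => //; apply: cvgZl_tmp.
Qed.

Lemma closure_rel_norm P : gram_rel P -> forall x y, closure_rel P x y ->
  `|x| = `|y|.
Proof.
move=> PP x y [u [v [uv /cvg_norm ux /cvg_norm vy]]].
have {}ux : (fun n => `|u n| : R[i]^o) @ \oo --> (`|x| : R[i]^o) by exact: ux.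
have {}vy : (fun n => `|v n| : R[i]^o) @ \oo --> (`|y| : R[i]^o) by exact: vy.
rewrite -(@cvg_lim R[i]^o _ _ _ _ _ _ ux)//.
rewrite -(@cvg_lim R[i]^o _ _ _ _ _ _ vy)//.
congr (lim (_ @ \oo)); apply/funext => n.
by apply/dotxx_inj; apply: (span_rel_dot PP).
Qed.

(** Take [u n] in the span of the first components whose distances to [x] tend
to the infimum. The parallelogram law makes [u] Cauchy, minimality makes the
limit of [x - u n] orthogonal to every first component, so it vanishes as these
are total. The partners of the [u n] are Cauchy too, since [span_rel P] is
isometric. *)
Lemma closure_rel_total P : gram_rel P -> (forall a b, P a b -> `|a| = 1) ->
  (forall x, (forall a b, P a b -> dot x a = 0) -> x = 0) ->
  forall x, exists y, closure_rel P x y.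
Proof.
move=> PP P1 Ptot x.
pose S := [set normsq (x - u) | u in [set u | exists v, span_rel P u v]].
have Slb : has_lbound S by exists 0 => _ [u _ <-]; exact: normsq_ge0.
have Sinf : has_inf S.
  by split=> //; exists (normsq (x - 0)); exists 0 => //; exists 0; exact: span_rel0.
have /choice[u uP] : forall n, exists u : E, (exists v, span_rel P u v) /\
    normsq (x - u) < inf S + n.+1%:R^-1.
  move=> n; have [|_ [u uv <-] lt] := @inf_adherent _ S n.+1%:R^-1 _ Sinf.
    by rewrite invr_gt0.
  by exists u.
have /choice[v uv] : forall n, exists v, span_rel P (u n) v by move=> n; case: (uP n).
have uinf n : normsq (x - u n) < inf S + n.+1%:R^-1 by case: (uP n).
have uC n m : (n <= m)%N -> normsq (u n - u m) <= 4 * n.+1%:R^-1.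
  move=> nm; rewrite (parallelogram x).
  have h : inf S <= normsq (x - 2^-1 *: (u n + u m)).
    apply: ge_inf => //; exists (2^-1 *: (u n + u m)) => //.
    exists (2^-1 *: (v n + v m)); rewrite -[_ *: (u n + _)]addr0 -[_ *: (v n + _)]addr0.
    apply: span_rel_linear; last exact: span_rel0.
    rewrite -[u n]scale1r -[v n]scale1r.
    exact: span_rel_linear.
  have hm : (m.+1%:R^-1 : R) <= n.+1%:R^-1.
    by rewrite lef_pV2 ?posrE// ler_nat.
  move: (uinf n) (uinf m) h hm.
  move: (normsq _) (normsq _) (normsq _) (inf S) (_^-1) (_^-1) => a b c d e f.
  lra.
have /cvg_ex[x' ux'] := cvgn_normsq uC.
have vC n m : (n <= m)%N -> normsq (v n - v m) <= 4 * n.+1%:R^-1.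
  move=> nm; rewrite (_ : normsq _ = normsq (u n - u m)) ?uC//.
  rewrite /normsq -!dotxx; congr (complex.Re _); apply/esym.
  have := span_rel_linear (-1) (uv m) (uv n).
  rewrite !scaleN1r (addrC _ (u n)) (addrC _ (v n)) => uvB.
  exact: (span_rel_dot PP).
have /cvg_ex[y vy] := cvgn_normsq vC.
suff -> : x = x' by exists y, u, v.
apply/eqP; rewrite -subr_eq0; apply/eqP/Ptot => a b Pab.
have small n : `|dot (x - u n) a| ^+ 2 <= (n.+1%:R^-1)%:C%C.
  rewrite -[_ ^+ 2](subKr (normsq (x - u n))%:C%C) -(normsqBZ _ (P1 _ _ Pab)).
  rewrite -rmorphB lecR lerBlDr.
  apply: (le_trans (ltW (uinf n))); rewrite addrC lerD2l.
  apply: ge_inf => //; exists (u n + dot (x - u n) a *: a).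
    exists (v n + dot (x - u n) a *: b); rewrite ![_ n + _]addrC.
    exact: span_relD.
  by rewrite opprD addrA.
apply/eqP; rewrite -normr_eq0 eq_le normr_ge0 andbT.
apply/ler_addgt0Pr => _ /complex_pos[d d0 ->]; rewrite add0r.
have d20 : 0 < d / 2 by rewrite divr_gt0.
have d220 : 0 < (d / 2) ^+ 2 by rewrite exprn_gt0.
move/cvgrPdist_lt : ux' => /(_ (d / 2)%:C%C); rewrite ltcR => /(_ d20) ux'.
near \oo => n.
have -> : x - x' = (x - u n) - (x' - u n) by rewrite opprB addrA subrK.
rewrite dotBl (le_trans (ler_normB _ _))// [d]splitr rmorphD /= lerD//.
  rewrite -(@ler_pXn2r _ 2) ?nnegrE ?normr_ge0 ?lecR ?(ltW d20)//.
  rewrite (le_trans (small n))// -rmorphXn /= lecR ltW//.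
  near: n; exact: (near_infty_natSinv_lt (PosNum d220)).
rewrite (le_trans (Defs.CauchySchwarz _ _))// (P1 _ _ Pab) mulr1 ltW//.
near: n; exact: ux'.
Unshelve. all: by end_near. Qed.

End total_correspondence.

Lemma span_rel_flip (R : realType) (E F : hilbertType R[i]) (P : E -> F -> Prop) x y :
  span_rel (fun b a => P a b) x y -> span_rel P y x.
Proof. by elim=> [|c a b u v Pab _ IH]; [exact: span_rel0|exact: span_relD]. Qed.

(** The closed span of the graph of a bijection between orthonormal bases is
total on both sides, hence the graph of a unitary. *)
Lemma same_dimension_exists_unitary (R : realType) (E F : hilbertType R[i]) :
  same_dimension E F -> exists W : E -> F,
    similarity 1 W /\ forall y, exists x, W x = y.
Proof.
move=> [A [B [[A1 AO AC] [B1 BO BC] /card_set_bijP[beta [AB binj bsurj]]]]].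
pose P a b := A a /\ beta a = b.
have PP : gram_rel P.
  move=> a _ a' _ [Aa <-] [Aa' <-].
  have [<-|aa'] := pselect (a = a').
    by rewrite !dotxx A1// B1//; exact: AB.
  rewrite AO// BO//; [exact: AB|exact: AB|].
  by move=> /(binj _ _ (mem_set Aa) (mem_set Aa')).
have Ptot x : (forall a b, P a b -> dot x a = 0) -> x = 0.
  move=> h; suff: orthocomplement A x by rewrite AC.
  by move=> a Aa; exact: h (conj Aa erefl).
have Ptot' y : (forall b a, P a b -> dot y b = 0) -> y = 0.
  move=> h; suff : orthocomplement B y by rewrite BC.
  by move=> b /bsurj[a Aa ab]; exact: (h b a (conj Aa ab)).
have [W WP] := choice (closure_rel_total PP (fun a b Pab => A1 a Pab.1) Ptot).
have Wuniq x y : closure_rel P x y -> W x = y.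
  move=> xy; apply/eqP; rewrite -subr_eq0 -normr_eq0.
  have := closure_rel_linear (-1) xy (WP x).
  by rewrite !scaleN1r ![- _ + _]addrC => /(closure_rel_norm PP) <-; rewrite subrr normr0.
have Wlin : linear W.
  by move=> t x y; apply: Wuniq; apply: closure_rel_linear; exact: WP.
exists W; split.
  split=> // x y; rewrite mul1r; apply: isometry_dot => // z.
  by apply/esym; exact: (closure_rel_norm PP).
move=> y; have PP' : gram_rel (fun b a => P a b).
  by move=> ? ? ? ? h h'; rewrite (PP _ _ _ _ h h').
have Pb1 b a : P a b -> `|b| = 1 by move=> [Aa <-]; apply: B1; exact: AB.
have [x [u [v [uv uy vx]]]] := closure_rel_total PP' Pb1 Ptot' y.
exists x; apply: Wuniq; exists v, u; split => // n.
exact: span_rel_flip.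
Qed.

(** * The building blocks of the invariant subspaces *)

Section ranges.
Context (R : realType).

Lemma heval2_phi (phi : R[i] -> R[i]) (Hphi : inner_function phi) (F : H2D2 R)
    z1 z2 : disk z1 -> disk z2 ->
  heval2 (hmap (mulop_similarity Hphi) F) z1 z2 = phi z2 * heval2 F z1 z2.
Proof.
move=> z1D z2D; rewrite /heval2.
rewrite (heval_hmap (mulop_similarity Hphi) F z1D).
exact: (heval_mulop Hphi (heval F z1) z2D).
Qed.

Lemma phi_z2_rangeE (phi : R[i] -> R[i]) (Hphi : inner_function phi) :
  phi_z2_range phi = range (hmap (mulop_similarity Hphi)).
Proof.
apply/seteqP; split => [G [F GF]|_ [F _ <-]]; exists F.
- by [].
- apply: heval_inj => z1 z1D; apply: heval_inj => z2 z2D.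
  exact: (etrans (heval2_phi Hphi F z1D z2D) (esym (GF z1 z2 z1D z2D))).
- exact: heval2_phi.
Qed.

Lemma scale_similarity (g : H2 R) :
  similarity (dot g g) (fun c : R[i]^o => c *: g).
Proof.
split=> [a x y|x y].
  by rewrite scalerDl -scalerA.
by rewrite dotZl dotZr mulrA mulrC.
Qed.

Lemma heval2_g (g : H2 R) (h : H2 R) z1 z2 : disk z1 -> disk z2 ->
  heval2 (hmap (scale_similarity g) h) z1 z2 = heval g z2 * heval h z1.
Proof.
move=> z1D z2D; rewrite /heval2 (heval_hmap (scale_similarity g) h z1D).
by rewrite (hevalZ _ _ z2D) mulrC.
Qed.

Lemma g_z2_rangeE (g : H2 R) : g_z2_range g = range (hmap (scale_similarity g)).
Proof.
apply/seteqP; split => [G [F GF]|_ [F _ <-]]; exists F.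
- by [].
- apply: heval_inj => z1 z1D; apply: heval_inj => z2 z2D.
  exact: (etrans (heval2_g g F z1D z2D) (esym (GF z1 z2 z1D z2D))).
- exact: heval2_g.
Qed.

(** The maps [m] on [H^2(D)] and [J] on [H^2(D^2)] are multiplication by [phi] and
by [phi(z_2)]; the equation [J F n = m (F n)] is the coefficientwise form of the
latter, the coefficients being taken in [z_1]. *)
Lemma phi_maps (phi : R[i] -> R[i]) : inner_function phi ->
  exists (m : H2 R -> H2 R) (J : H2D2 R -> H2D2 R),
    [/\ similarity 1 m /\ similarity 1 J,
        forall f, m (hshift f) = hshift (m f),
        forall F n, J F n = m (F n),
        mulop_range (scalar_operator phi) = range m /\
          phi_z2_range phi = range J &
        forall f z, disk z -> heval (m f) z = phi z * heval f z].
Proof.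
move=> Hphi; exists (mulop Hphi), (hmap (mulop_similarity Hphi)); split.
- split; first exact: (mulop_similarity Hphi).
  exact: (hmap_similarity (mulop_similarity Hphi)).
- exact: (mulop_hshift Hphi).
- by [].
- by split; [exact: (mulop_rangeE Hphi)|exact: phi_z2_rangeE].
- exact: (heval_mulop Hphi).
Qed.

Lemma g_map (g : H2 R) : exists J : H2 R -> H2D2 R,
  [/\ similarity (dot g g) J, forall h n, J h n = (h n : R[i]) *: g &
      g_z2_range g = range J].
Proof.
exists (hmap (scale_similarity g)); split.
- exact: (hmap_similarity (scale_similarity g)).
- by [].
- exact: g_z2_rangeE.
Qed.

Lemma Psi_map (E : hilbertType R[i]) (Psi : R[i] -> E -> H2 R) :
  inner_operator Psi -> exists K : hardy E -> H2D2 R,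
  [/\ similarity 1 K, forall k, K (hshift k) = hshift (K k) &
      mulop_range Psi = range K].
Proof. exact (fun HPsi => mulop_map HPsi). Qed.

End ranges.

(** * The norm identities of the Brownian shifts *)

Section brownian.
Context (R : realType).

Lemma dot_hsumE (E F : innerType R[i]) (x y : hsum E F) :
  dot x y = dot x.1 y.1 + dot x.2 y.2.
Proof. by []. Qed.

Lemma expi_norm (theta : R) : `|expi theta| = 1.
Proof. by rewrite normc_def /= cos2Dsin2 sqrtr1. Qed.

Lemma expi_inj (a b : R) : 0 <= a < 2 * pi -> 0 <= b < 2 * pi ->
  expi a = expi b -> a = b.
Proof.
wlog ab : a b / b <= a.
  move=> H ha hb ab; have [ba|/ltW ba] := leP b a; first exact: H.
  by apply/esym; apply: H.
move=> /andP[a0 a2] /andP[b0 b2] [cE sE].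
have c1 : cos (a - b) = 1 by rewrite cosB cE sE -!expr2 cos2Dsin2.
set d := (a - b) / 2; have dE : a - b = d *+ 2 by rewrite -mulr_natr divfK.
have : sin d = 0.
  apply/eqP; rewrite -sqrf_eq0; move: c1; rewrite dE cos_mulr2n cos2sin2 => h.
  by apply/eqP; move: h; rewrite -mulr_natr; lra.
have d0 : 0 <= d by rewrite divr_ge0// subr_ge0.
have dpi : d < pi by rewrite /d; lra.
move: d0; rewrite le_eqVlt => /orP[/eqP d0 _|d0 sd].
  by apply/eqP; rewrite -subr_eq0 dE -d0 mul0rn.
by have := @sin_gt0_pi R d; rewrite d0 dpi sd ltxx => /(_ isT).
Qed.

(** The compression of the 3-Brownian shift to [H^2(D) (+) C], that is, the
2-Brownian shift. *)
Definition brownian2 (sigma theta : R) (m : hsum (H2 R) R[i]^o) :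
    hsum (H2 R) R[i]^o :=
  (hshift m.1 + sigma%:C%C *: hconst m.2, expi theta * m.2).

Lemma brownian_shiftE sigma theta (F : H2D2 R) m :
  brownian_shift sigma theta (F, m) =
  (hshift F + sigma%:C%C *: hconst m.1, brownian2 sigma theta m).
Proof. by case: m. Qed.

Lemma realC_conj (s : R) : Num.conj (s%:C%C : R[i]) = s%:C%C.
Proof. by rewrite /Num.conj /= oppr0. Qed.

(** [z f] is orthogonal to the constants, so no cross terms appear. *)
Lemma dot_hshift_const (E : innerType R[i]) (f f' : hardy E) (e e' : E)
    (s : R) :
  dot (hshift f + s%:C%C *: hconst e) (hshift f' + s%:C%C *: hconst e') =
  dot f f' + (s%:C%C) ^+ 2 * dot e e'.
Proof.
rewrite dotDl !dotDr !dotZl !dotZr !dot_hshift !dot_hconst dot_hconst_hshift.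
by rewrite (dot_sym0 (dot_hconst_hshift _ _)) realC_conj; ring.
Qed.

Lemma dot_brownian2 sigma theta m :
  dot (brownian2 sigma theta m) (brownian2 sigma theta m) =
  dot m m + (sigma%:C%C) ^+ 2 * dot m.2 m.2.
Proof.
rewrite !dot_hsumE dot_hshift_const /=.
have -> : dot (expi theta * m.2 : R[i]^o) (expi theta * m.2) = dot m.2 m.2.
  by rewrite !dotxx normrM expi_norm mul1r.
by rewrite addrAC.
Qed.

Lemma dot_brownian sigma theta (F : H2D2 R) m :
  dot (brownian_shift sigma theta (F, m)) (brownian_shift sigma theta (F, m)) =
  dot F F + dot m m + (sigma%:C%C) ^+ 2 * dot m m.
Proof.
rewrite brownian_shiftE dot_hsumE dot_hshift_const dot_brownian2 [in RHS]dot_hsumE.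
by rewrite /= !dot_hsumE /=; ring.
Qed.

End brownian.

(** * An intertwining unitary is diagonal *)

Section splitting.
Context (R : realType).
Notation H1C := (hsum (H2 R) R[i]^o).
Implicit Types (sigma theta : R) (F : H2D2 R) (m : H1C).

Lemma subspaceZ (E : innerType R[i]) (A : set E) a x :
  Defs.subspace A -> A x -> A (a *: x).
Proof. by move=> [A0 Alin] Ax; rewrite -[a *: x]addr0; exact: Alin. Qed.

Lemma brownian_shift_inl sigma theta F :
  brownian_shift sigma theta (F, 0) = (hshift F, 0).
Proof.
rewrite brownian_shiftE /brownian2 /=.
have -> : hconst (0 : H2 R) = 0 by exact: hconst0.
have -> : hconst (0 : R[i]^o) = 0 by exact: hconst0.
have -> : hshift (0 : H2 R) = 0 by apply: hardyP => -[].
by rewrite !scaler0 !addr0 mulr0.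
Qed.

Lemma brownian_shift_inr sigma theta m :
  brownian_shift sigma theta (0, m) =
  (sigma%:C%C *: hconst m.1, brownian2 sigma theta m).
Proof.
rewrite brownian_shiftE.
have -> : hshift (0 : H2D2 R) = 0 by apply: hardyP => -[].
by rewrite add0r.
Qed.

Lemma dsum_subspace (E F : innerType R[i]) (A : set E) (B : set F) :
  Defs.subspace (dsum A B) -> Defs.subspace A /\ Defs.subspace B.
Proof.
move=> [[A0 B0] ABlin]; split; split=> // a x y Ax Ay.
  by have [] := ABlin a (x, 0) (y, 0) (conj Ax B0) (conj Ay B0).
by have [] := ABlin a (0, x) (0, y) (conj A0 Ax) (conj A0 Ay).
Qed.

Lemma dsum_invariant sigma theta (M0 : set (H2D2 R)) (M1 : set H1C) :
  0 < sigma ->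
  closed_invariant_subspace (brownian_shift sigma theta) (dsum M0 M1) ->
  [/\ Defs.subspace M0 /\ Defs.subspace M1,
      forall F, M0 F -> M0 (hshift F),
      forall m, M1 m -> M1 (brownian2 sigma theta m) &
      forall m, M1 m -> M0 (hconst m.1)].
Proof.
move=> sigma0 [/dsum_subspace[sM0 sM1] _ inv]; split=> //.
- move=> F M0F; have : dsum M0 M1 (F, 0) by split=> //; exact: sM1.1.
  by move=> /(imageP (brownian_shift sigma theta))/inv; rewrite brownian_shift_inl => -[].
- move=> m M1m; have : dsum M0 M1 (0, m) by split=> //; exact: sM0.1.
  by move=> /(imageP (brownian_shift sigma theta))/inv; rewrite brownian_shift_inr => -[].
- move=> m M1m; have : dsum M0 M1 (0, m) by split=> //; exact: sM0.1.
  move=> /(imageP (brownian_shift sigma theta))/inv; rewrite brownian_shift_inr => -[+ _].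
  move=> /(subspaceZ (sigma%:C%C)^-1 sM0) /=.
  rewrite scalerA mulVf ?scale1r//.
  by rewrite gt_eqF// ltcR.
Qed.

(** By [dot_brownian] an intertwining unitary preserves [sigma |m|]. The vectors
with [m = 0] thus go onto the vectors with [m = 0], and so do their orthogonal
complements. Since [U] is then diagonal, [U T = T U] splits into the intertwining
relations for the two diagonal entries and one for the coupling term
[sigma f_(z_2)]. *)
Lemma unitarily_equivalent_split sigma1 sigma2 theta1 theta2
    (M0 N0 : set (H2D2 R)) (M1 N1 : set H1C) :
  0 < sigma1 -> 0 < sigma2 ->
  closed_invariant_subspace (brownian_shift sigma1 theta1) (dsum M0 M1) ->
  closed_invariant_subspace (brownian_shift sigma2 theta2) (dsum N0 N1) ->
  unitarily_equivalent (brownian_shift sigma1 theta1) (dsum M0 M1)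
    (brownian_shift sigma2 theta2) (dsum N0 N1) ->
  exists (u0 : H2D2 R -> H2D2 R) (u1 : H1C -> H1C),
  [/\ [/\ u0 @` M0 = N0, forall F G, M0 F -> M0 G -> dot (u0 F) (u0 G) = dot F G &
          forall F, M0 F -> u0 (hshift F) = hshift (u0 F)],
      [/\ u1 @` M1 = N1, forall m n, M1 m -> M1 n -> dot (u1 m) (u1 n) = dot m n &
          forall m, M1 m -> u1 (brownian2 sigma1 theta1 m) =
            brownian2 sigma2 theta2 (u1 m)],
      forall m, M1 m -> sigma1%:C%C *: u0 (hconst m.1) =
        sigma2%:C%C *: hconst (u1 m).1 &
      forall m, M1 m -> (sigma1%:C%C) ^+ 2 * dot m m =
        (sigma2%:C%C) ^+ 2 * dot (u1 m) (u1 m)].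
Proof.
move=> s10 s20 Minv Ninv [U [Ulin UMN Udot UT]].
have [[sM0 sM1] M0sh M1sh M1M0] := dsum_invariant s10 Minv.
have [[sN0 sN1] _ _ _] := dsum_invariant s20 Ninv.
have s2sq : (sigma2%:C%C : R[i]) ^+ 2 != 0.
  by rewrite expf_neq0// gt_eqF// ltcR.
have s1sq : (sigma1%:C%C : R[i]) ^+ 2 != 0.
  by rewrite expf_neq0// gt_eqF// ltcR.
have NU x : dsum M0 M1 x -> dsum N0 N1 (U x).
  by move=> Mx; rewrite -UMN; exists x.
have M0i F : M0 F -> dsum M0 M1 (F, 0) by move=> MF; split=> //; exact: sM1.1.
have M1i m : M1 m -> dsum M0 M1 (0, m) by move=> Mm; split=> //; exact: sM0.1.
have key x : dsum M0 M1 x -> (sigma1%:C%C) ^+ 2 * dot x.2 x.2 =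
    (sigma2%:C%C) ^+ 2 * dot (U x).2 (U x).2.
  move=> Mx; have MTx : dsum M0 M1 (brownian_shift sigma1 theta1 x).
    by have [_ _] := Minv; apply; exists x.
  have := Udot _ _ MTx MTx; rewrite UT//.
  have := Udot _ _ Mx Mx.
  case: x (U x) Mx MTx => [F m] [G n] _ _.
  rewrite !dot_brownian !dot_hsumE /= => -> /addrI.
  by move->.
have U0 F : M0 F -> (U (F, 0)).2 = 0.
  move=> /M0i MF; apply: dot_eq0; have /eqP := key _ MF.
  by rewrite dot0l mulr0 eq_sym mulf_eq0 (negbTE s2sq) => /eqP.
have U0E F : M0 F -> U (F, 0) = ((U (F, 0)).1, 0).
  by move=> MF; have := U0 _ MF; case: (U (F, 0)) => a b /= ->.
have U0onto G : N0 G -> exists2 F, M0 F & U (F, 0) = (G, 0).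
  move=> NG; have : dsum N0 N1 (G, 0) by split=> //; exact: sN1.1.
  rewrite -UMN => -[[F m] Mx UF].
  have /eqP := key _ Mx; rewrite UF /= dot0l mulr0 mulf_eq0 (negbTE s1sq).
  by move=> /eqP/dot_eq0 m0; exists F; [exact: Mx.1|rewrite -UF m0].
have U1 m : M1 m -> (U (0, m)).1 = 0.
  move=> Mm; have [NUm _] := NU _ (M1i _ Mm).
  have [F MF UF] := U0onto _ NUm.
  apply: dot_eq0; have := Udot _ _ (M1i _ Mm) (M0i _ MF).
  by rewrite UF !dot_hsumE /= !dot0l !dot0r !addr0.
have U1E m : M1 m -> U (0, m) = (0, (U (0, m)).2).
  by move=> Mm; have := U1 _ Mm; case: (U (0, m)) => a b /= ->.
pose u0 F := (U (F, 0)).1; pose u1 m := (U (0, m)).2.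
have Usplit F m : M0 F -> M1 m -> U (F, m) = (u0 F, u1 m).
  move=> MF Mm; have := Ulin 1 (F, 0) (0, m) (M0i _ MF) (M1i _ Mm).
  rewrite !scale1r U0E// U1E//.
  rewrite (_ : (F, 0) + (0, m) = ((F, m) : brownian_space R)); last first.
    by congr (_, _); rewrite ?addr0 ?add0r.
  by move->; congr (_, _); rewrite ?addr0 ?add0r.
have UT1 m : M1 m -> sigma1%:C%C *: u0 (hconst m.1) = sigma2%:C%C *: hconst (u1 m).1
    /\ u1 (brownian2 sigma1 theta1 m) = brownian2 sigma2 theta2 (u1 m).
  move=> Mm; have := UT _ (M1i _ Mm).
  rewrite brownian_shift_inr U1E// brownian_shift_inr.
  rewrite (Usplit _ _ (subspaceZ _ sM0 (M1M0 _ Mm)) (M1sh _ Mm)).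
  move=> [E1 E2]; split; last exact: E2.
  rewrite -E1 /u0.
  have Mz : dsum M0 M1 0 := conj sM0.1 sM1.1.
  have := Ulin (sigma1%:C%C) (hconst m.1, 0) 0 (M0i _ (M1M0 _ Mm)) Mz.
  have -> : U 0 = 0.
    by apply: dot_eq0; rewrite (Udot _ _ Mz Mz) dot0l.
  rewrite !addr0 => E3.
  transitivity (U (sigma1%:C%C *: ((hconst m.1, 0) : brownian_space R))).1.
    by rewrite E3.
  congr (U _).1; congr (_, _); exact: scaler0.
exists u0, u1; split=> [||m /UT1[]//|m Mm]; last exact: (key _ (M1i _ Mm)).
  split.
  - apply/seteqP; split=> [_ [F MF <-]|G NG]; first exact: (NU _ (M0i _ MF)).1.
    by have [F MF UF] := U0onto _ NG; exists F => //; rewrite /u0 UF.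
  - move=> F G MF MG; have := Udot _ _ (M0i _ MF) (M0i _ MG).
    by rewrite U0E// (U0E G)// dot_hsumE [in RHS]dot_hsumE /= !dot0l !addr0.
  - move=> F MF; have := UT _ (M0i _ MF); rewrite brownian_shift_inl (U0E F)//.
    by rewrite brownian_shift_inl (U0E (hshift F)) => [[]|]; last exact: M0sh.
split.
- apply/seteqP; split=> [_ [m Mm <-]|n Nn]; first exact: (NU _ (M1i _ Mm)).2.
  have : dsum N0 N1 (0, n) by split=> //; exact: sN0.1.
  rewrite -UMN => -[[F m] [/= MF Mm]].
  rewrite Usplit// => -[_ un]; by exists m.
- move=> m n Mm Mn; have := Udot _ _ (M1i _ Mm) (M1i _ Mn).
  by rewrite U1E// (U1E n)// dot_hsumE [in RHS]dot_hsumE /= !dot0l !add0r.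
- by move=> m /UT1[].
Qed.

End splitting.

(** * A common description of the two lifted types *)

Section model.
Context (R : realType).
Notation H1C := (hsum (H2 R) R[i]^o).

(** [S] is the graph of a unitary commuting with the shifts. If [S] relates a
constant [e] to [l], then [l] is constant: [z (bshift l)] is the partner of some
[z k], and [e] is orthogonal to [z k]. *)
Lemma wandering_unitary (E F : innerType R[i]) (S : hardy E -> hardy F -> Prop) :
  (forall k l k' l', S k l -> S k' l' -> dot k k' = dot l l') ->
  (forall k l, S k l -> S (hshift k) (hshift l)) ->
  (forall k, exists l, S k l) -> (forall l, exists k, S k l) ->
  exists W : E -> F,
    (forall x y, dot (W x) (W y) = dot x y) /\ forall y, exists x, W x = y.
Proof.
move=> Sdot Ssh Sl Sr.
have const (E' F' : innerType R[i]) (S' : hardy E' -> hardy F' -> Prop) :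
    (forall k l k' l', S' k l -> S' k' l' -> dot k k' = dot l l') ->
    (forall k l, S' k l -> S' (hshift k) (hshift l)) ->
    (forall k, exists l, S' k l) -> (forall l, exists k, S' k l) ->
    forall e, exists e', S' (hconst e) (hconst e').
  move=> Sdot' Ssh' Sl' Sr' e; have [l Sel] := Sl' (hconst e).
  have [k Skl] := Sr' (bshift l); exists (l 0%N).
  suff l0 : bshift l = 0.
    have l_split := hardy_split l; rewrite l0 in l_split.
    have hshift0 : hshift (0 : hardy F') = 0 by apply: hardyP => -[].
    by rewrite hshift0 addr0 in l_split; rewrite -l_split.
  apply: dot_eq0; rewrite -dot_hshiftr -(Sdot' _ _ _ _ Sel (Ssh' _ _ Skl)).
  exact: dot_hconst_hshift.
have [W WP] := choice (const _ _ S Sdot Ssh Sl Sr).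
exists W; split=> [x y|y].
  by rewrite -dot_hconst -(Sdot _ _ _ _ (WP x) (WP y)) dot_hconst.
have [||x Sxy] := const _ _ (fun l k => S k l) _ _ Sr Sl y.
- by move=> k l k' l' Skl Skl'; apply/esym; exact: Sdot.
- by move=> k l; exact: Ssh.
exists x; apply/eqP; rewrite -subr_eq0; apply/eqP/dot_eq0.
have Sx := WP x.
rewrite !dotBl !dotBr -(dot_hconst (W x)) -(dot_hconst (W x)) -(dot_hconst y).
rewrite -(dot_hconst y) -(Sdot _ _ _ _ Sx Sx) -(Sdot _ _ _ _ Sx Sxy).
by rewrite -(Sdot _ _ _ _ Sxy Sx) -(Sdot _ _ _ _ Sxy Sxy) !subrr.
Qed.

(** Both types at once: [b] tells whether the coordinate [alpha] occurs. For
Type II, [b = true] and [l] is the boundary value of [phi]. Type I is the case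
[b = false], with [g = 0] and an arbitrary unimodular [l]. The maps [m], [J],
[G], [K] are multiplication by [phi], [phi(z_2)], [g(z_2)] and [Psi]. *)
Definition brownian_model (b : bool) (sigma theta : R) (E : hilbertType R[i])
    (M0 : set (H2D2 R)) (M1 : set H1C) (g : H2 R) (l : R[i])
    (m : H2 R -> H2 R) (J : H2D2 R -> H2D2 R) (G : H2 R -> H2D2 R)
    (K : hardy E -> H2D2 R) : Prop :=
  [/\ [/\ similarity 1 m, similarity 1 J, forall f, m (hshift f) = hshift (m f) &
          forall F n, J F n = m (F n)],
      [/\ similarity (dot g g) G, forall h n, G h n = (h n : R[i]) *: g &
          b = false -> g = 0],
      similarity 1 K /\ (forall k, K (hshift k) = hshift (K k)),
      [/\ forall F h, dot (J F) (G h) = 0, forall F k, dot (J F) (K k) = 0,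
          forall h k, dot (G h) (K k) = 0 & forall f, dot g (m f) = 0] &
      [/\ M0 = [set x | exists F h k, x = J F + G h + K k],
          M1 = [set p | exists f (a : R[i]), (b = false -> a = 0) /\
                          p = (a *: g + m f, a)],
          `|l| = 1 &
          b = true -> hshift g + sigma%:C%C *: hconst (1 : R[i]^o) =
            expi theta *: g + (sigma%:C%C * Num.conj l) *: m (hconst (1 : R[i]^o))]].

(** The definition of [g] with the denominator cleared:
[T1 (g, 1) = e^(i theta) (g, 1) + sigma (conj l) (phi, 0)]. *)
Lemma brownian_g_identity sigma theta (phi : R[i] -> R[i]) (g : H2 R) (l : R[i])
    (m : H2 R -> H2 R) :
  (forall f z, disk z -> heval (m f) z = phi z * heval f z) ->
  (forall z, disk z -> heval g z = sigma%:C%C * ((Num.conj l * phi z - 1) /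
    (z - expi theta))) ->
  hshift g + sigma%:C%C *: hconst (1 : R[i]^o) =
    expi theta *: g + (sigma%:C%C * Num.conj l) *: m (hconst (1 : R[i]^o)).
Proof.
move=> mE gE; apply: heval_inj => z zD.
have ze : z - expi theta != 0.
  rewrite subr_eq0; apply/eqP => zE; move: zD; rewrite /disk /= zE.
  by rewrite expi_norm ltxx.
rewrite (hevalD _ _ zD) (heval_hshift _ zD) (hevalZ _ _ zD) (heval_hconst _ zD).
rewrite (hevalD _ _ zD) !(hevalZ _ _ zD) (mE _ _ zD) (heval_hconst _ zD).
rewrite (gE _ zD).
change (z * (sigma%:C%C * ((Num.conj l * phi z - 1) / (z - expi theta)))
  + sigma%:C%C * 1 = expi theta * (sigma%:C%C * ((Num.conj l * phi z - 1) /
  (z - expi theta))) + sigma%:C%C * Num.conj l * (phi z * 1)).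
move: (expi theta) (sigma%:C%C) (Num.conj l) (phi z) ze => e s l' p ze.
by field.
Qed.

(** [|T1 (g, 1)|^2] is [|(g, 1)|^2 + sigma^2] by [dot_brownian2], and
[|(g, 1)|^2 + sigma^2 |l|^2] because [(g, 1)] is orthogonal to [(phi, 0)] and
[phi] has norm one. *)
Lemma brownian_g_unimodular sigma theta (g : H2 R) (l : R[i]) (m : H2 R -> H2 R) :
  0 < sigma -> similarity 1 m -> (forall f, dot g (m f) = 0) ->
  hshift g + sigma%:C%C *: hconst (1 : R[i]^o) =
    expi theta *: g + (sigma%:C%C * Num.conj l) *: m (hconst (1 : R[i]^o)) ->
  `|l| = 1.
Proof.
move=> sigma0 msim gm gE.
have := dot_brownian2 sigma theta ((g, 1) : H1C).
rewrite {1 2}/brownian2 /= gE !dot_hsumE /= mulr1.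
rewrite !dotDl !dotDr !dotZl !dotZr gm (dot_sym0 (gm _)) msim.2 dot_hconst.
have e1 : dot (expi theta : R[i]^o) (expi theta : R[i]^o) = 1.
  by rewrite dotxx expi_norm expr1n.
have d1 : dot (1 : R[i]^o) (1 : R[i]^o) = 1 by rewrite dotxx normr1 expr1n.
have ee : expi theta * (Num.conj (expi theta) * dot g g) = dot g g.
  by rewrite mulrA -normCK expi_norm expr1n mul1r.
have s0 : (sigma%:C%C : R[i]) != 0 by rewrite gt_eqF// ltcR.
rewrite e1 d1 ee !mulr0 !addr0 !add0r !mulr1 rmorphM /= realC_conj conjCK.
rewrite addrAC => /addrI h.
have : `|l| ^+ 2 = 1.
  apply: (mulfI (expf_neq0 2 s0)); rewrite mulr1 -[RHS]h normCK; ring.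
by move=> /eqP; rewrite sqrp_eq1// => /eqP.
Qed.

(** Type I fills the slots of [g] and [G] with zero. *)
Lemma orthogonal_sum2_model sigma theta (E : hilbertType R[i])
    (phi : R[i] -> R[i]) (M0 A B : set (H2D2 R)) (M1 : set H1C) :
  inner_function phi -> phi_z2_range phi = A ->
  (exists K : hardy E -> H2D2 R, [/\ similarity 1 K,
    forall k, K (hshift k) = hshift (K k) & B = range K]) ->
  M1 = dsum (mulop_range (scalar_operator phi)) [set 0] ->
  is_orthogonal_sum2 M0 A B ->
  exists g l m J G (K : hardy E -> H2D2 R),
    brownian_model false sigma theta M0 M1 g l m J G K.
Proof.
move=> Hphi phiA [K [Ksim Ksh Kr]] M1E [ort M0E].
have [m [J [[msim Jsim] msh JE [mr Jr] _]]] := phi_maps Hphi.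
rewrite {}phiA in Jr.
have [G [Gsim GE _]] := g_map (0 : H2 R).
have G0 h : G h = 0 by apply: hardyP => n; rewrite GE scaler0.
have JK F k : dot (J F) (K k) = 0.
  by apply: ort; [rewrite Jr; exists F|rewrite Kr; exists k].
have M0E' : M0 = [set x | exists F h k, x = J F + G h + K k].
  rewrite M0E Jr Kr; apply/seteqP; split.
    move=> _ [_ [F _ <-] [_ [k _ <-] <-]]; exists F, 0, k.
    by rewrite G0 addr0.
  move=> _ [F [h [k ->]]]; rewrite G0 addr0.
  exists (J F); first by exists F.
  by exists (K k); first by exists k.
have M1E' : M1 = [set p | exists f (a : R[i]), (false = false -> a = 0) /\
                          p = (a *: (0 : H2 R) + m f, a)].
  rewrite M1E mr; apply/seteqP; split=> [[x y]|].
    move=> [/= [f _ <-] ->]; exists f, 0; split; first by [].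
    by rewrite scaler0 add0r.
  move=> _ [f [a [/(_ erefl) -> ->]]].
  by split; [exists f; last by rewrite /= scaler0 add0r|].
exists 0, 1, m, J, G, K; split.
- by split.
- by split.
- by split.
- split; [by move=> F h; rewrite G0 dot0r|exact: JK| |].
    by move=> h k; rewrite G0 dot0l.
  by move=> f; rewrite dot0l.
- by split; [exact: M0E'|exact: M1E'|exact: normr1|].
Qed.

Lemma typeI_model sigma theta (E : hilbertType R[i]) (M0 : set (H2D2 R))
    (M1 : set H1C) : lifted_typeI E M0 M1 ->
  exists g l m J G (K : hardy E -> H2D2 R),
    brownian_model false sigma theta M0 M1 g l m J G K.
Proof.
move=> MI; refine (match MI with ex_intro phi (ex_intro Psi
  (And4 Hphi HPsi M1E sumM0)) => _ end).
exact: (orthogonal_sum2_model _ _ Hphi erefl (Psi_map (proj1 HPsi)) M1E sumM0).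
Qed.

Lemma orthogonal_sum3_model sigma theta (E : hilbertType R[i])
    (phi : R[i] -> R[i]) (g : H2 R) (M0 A B D : set (H2D2 R)) (M1 : set H1C) :
  0 < sigma -> inner_function phi -> is_brownian_g sigma theta phi g ->
  phi_z2_range phi = A -> g_z2_range g = B ->
  (exists K : hardy E -> H2D2 R, [/\ similarity 1 K,
    forall k, K (hshift k) = hshift (K k) & D = range K]) ->
  is_orthogonal_sum2 M1 (line ((g, 1) : H1C))
    (dsum (mulop_range (scalar_operator phi)) [set 0]) ->
  is_orthogonal_sum3 M0 A B D ->
  exists l m J G (K : hardy E -> H2D2 R),
    brownian_model true sigma theta M0 M1 g l m J G K.
Proof.
move=> sigma0 Hphi [l _ gE] phiA gB [K [Ksim Ksh Kr]] [ort1 M1E] [JG JK GK M0E].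
have [m [J [[msim Jsim] msh JE [mr Jr] mE]]] := phi_maps Hphi.
rewrite {}phiA in Jr.
have [G [Gsim GE Gr]] := g_map g; rewrite {}gB in Gr.
have id := brownian_g_identity mE gE.
have gm f : dot g (m f) = 0.
  have := ort1 (g, 1) (m f, 0); rewrite dot_hsumE /= dot0r addr0; apply.
    by exists 1; rewrite ?scale1r.
  by split=> //=; rewrite mr; exists f.
exists l, m, J, G, K; split=> //; split=> //.
- move=> F h; apply: JG; [rewrite Jr|rewrite Gr]; by [exists F|exists h].
- move=> F k; apply: JK; [rewrite Jr|rewrite Kr]; by [exists F|exists k].
- move=> h k; apply: GK; [rewrite Gr|rewrite Kr]; by [exists h|exists k].
- rewrite M0E; apply/seteqP; split=> [_ [_ [x + [y + <-]] [z + <-]]|_ [F [h [k ->]]]].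
    by rewrite Jr Gr Kr => -[F _ <-] [h _ <-] [k _ <-]; exists F, h, k.
  exists (J F + G h); last by exists (K k) => //; rewrite Kr; exists k.
  exists (J F); first by rewrite Jr; exists F.
  by exists (G h) => //; rewrite Gr; exists h.
- rewrite M1E; apply/seteqP; split=> [_ [_ [a _ <-] [[x y] [/= + ->] <-]]|_ [f [a [_ ->]]]].
    rewrite mr => -[f _ <-]; exists f, a; split=> //.
    by congr (_, _); rewrite /= addr0; exact: mulr1.
  exists (a *: ((g, 1) : H1C)); first by exists a.
  exists (m f, 0); first by split=> //=; rewrite mr; exists f.
  by congr (_, _); rewrite /= addr0; exact: mulr1.
- exact: (brownian_g_unimodular sigma0 msim gm id).
Qed.

Lemma typeII_model sigma theta (E : hilbertType R[i]) (M0 : set (H2D2 R))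
    (M1 : set H1C) phi g (Psi : R[i] -> E -> H2 R) : 0 < sigma ->
  lifted_typeII_with sigma theta M0 M1 phi g Psi ->
  exists l m J G (K : hardy E -> H2D2 R),
    brownian_model true sigma theta M0 M1 g l m J G K.
Proof.
move=> sigma0 MII; refine (match MII with And5 Hphi Hg (conj HPsi _) sumM1 sumM0
  => _ end).
exact: (orthogonal_sum3_model sigma0 Hphi Hg erefl erefl (Psi_map (proj1 HPsi))
  sumM1 sumM0).
Qed.

End model.

(** * Unitary invariants *)

Section model_equivalence.
Context (R : realType).
Notation H1C := (hsum (H2 R) R[i]^o).

(** A vector [J F + G h] has its coefficients in the space of first components
of [M1]; so if [x = J F + G h + K k] has coefficients orthogonal to that space,
the part [J F + G h] is orthogonal to itself coefficientwise. *)
Lemma model_range b sigma theta (E : hilbertType R[i]) (M0 : set (H2D2 R))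
    (M1 : set H1C) g l m J G (K : hardy E -> H2D2 R) :
  brownian_model b sigma theta M0 M1 g l m J G K ->
  range K = [set x | M0 x /\ forall n p, M1 p -> dot (x n) p.1 = 0].
Proof.
move=> [[msim Jsim msh JE] [Gsim GE g0] [Ksim Ksh] [JG JK GK gm] [-> -> _ _]].
have Jmon n f : J (hmonom n f) = hmonom n (m f).
  apply: hardyP => k; rewrite JE !hmonomE; case: eqP => // _.
  exact: (similarity0 msim).
have Gmon n : G (hmonom n (1 : R[i]^o)) = hmonom n g.
  apply: hardyP => k; rewrite GE !hmonomE; case: eqP => _.
    by rewrite scale1r.
  by rewrite scale0r.
have orth k n f (a : R[i]) : dot (K k n) (a *: g + m f) = 0.
  rewrite dotDr dotZr -!dot_hmonomr -Gmon -Jmon.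
  by rewrite (dot_sym0 (GK _ _)) (dot_sym0 (JK _ _)) mulr0 addr0.
apply/seteqP; split=> [_ [k _ <-]|x [[F [h [k ->]]] xP]].
  split; last by move=> n _ [f [a [_ ->]]]; exact: orth.
  exists 0, 0, k.
  by rewrite (similarity0 Jsim) (similarity0 Gsim) !add0r.
suff -> : J F + G h = 0 by exists k; rewrite ?add0r.
apply: hardyP => n; apply: dot_eq0; rewrite hardyDE JE GE addrC.
have := xP n (h n *: g + m (F n), if b then h n : R[i] else 0).
rewrite [X in dot _ X]/= !hardyDE JE GE dotDl orth addr0 (addrC (m _)); apply.
exists (F n), (if b then h n : R[i] else 0); split; first by case: (b).
by case: (b) g0 => // ->//; rewrite !scaler0.
Qed.

Lemma realC_inj (s t : R) : 0 < s -> 0 < t ->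
  (s%:C%C : R[i]) ^+ 2 = t%:C%C ^+ 2 -> s = t.
Proof.
move=> s0 t0 /eqP; rewrite eqrXn2 ?lecR ?ltW// => /eqP.
by move=> /(congr1 (@complex.Re R)).
Qed.

(** In terms of the diagonal entries [u0] and [u1] of the unitary: [sigma] comes
from the vector [(phi, 0)], [dim E] from [u0] on [Psi H^2(E)], the type from
[|alpha|], and [theta] and [|g|] from the image of [(g, 1)]. *)
Lemma model_equivalent_invariants b1 b2 sigma1 sigma2 theta1 theta2
    (E1 E2 : hilbertType R[i]) (M0 N0 : set (H2D2 R)) (M1 N1 : set H1C)
    g1 l1 m1 J1 G1 (K1 : hardy E1 -> H2D2 R)
    g2 l2 m2 J2 G2 (K2 : hardy E2 -> H2D2 R) :
  0 < sigma1 -> 0 < sigma2 ->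
  closed_invariant_subspace (brownian_shift sigma1 theta1) (dsum M0 M1) ->
  closed_invariant_subspace (brownian_shift sigma2 theta2) (dsum N0 N1) ->
  brownian_model b1 sigma1 theta1 M0 M1 g1 l1 m1 J1 G1 K1 ->
  brownian_model b2 sigma2 theta2 N0 N1 g2 l2 m2 J2 G2 K2 ->
  unitarily_equivalent (brownian_shift sigma1 theta1) (dsum M0 M1)
    (brownian_shift sigma2 theta2) (dsum N0 N1) ->
  [/\ sigma1 = sigma2, same_dimension E1 E2, b1 = b2 &
      b1 = true -> expi theta1 = expi theta2 /\ `|g1| = `|g2|].
Proof.
move=> s10 s20 Minv Ninv modM modN UMN.
have [u0 [u1 [[u0r u0dot u0sh] [u1r u1dot u1T] u0c u1s]]] :=
  unitarily_equivalent_split s10 s20 Minv Ninv UMN.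
have [_ M0sh _ M1M0] := dsum_invariant s10 Minv.
have rK1 := model_range modM; have rK2 := model_range modN.
have [[m1sim _ _ _] [_ _ _] [K1sim K1sh] [_ _ _ gm1] [_ M1E _ gE1]] := modM.
have [[m2sim _ _ _] [_ _ _] [K2sim K2sh] [_ _ _ gm2] [_ N1E _ gE2]] := modN.
have d1 : dot (1 : R[i]^o) (1 : R[i]^o) = 1 by rewrite dotxx normr1 expr1n.
have M1m f : M1 (m1 f, 0).
  by rewrite M1E; exists f, 0; rewrite scale0r add0r.
have N1m f : N1 (m2 f, 0).
  by rewrite N1E; exists f, 0; rewrite scale0r add0r.
have sE : sigma1 = sigma2.
  apply: realC_inj => //; have := u1s _ (M1m (hconst (1 : R[i]^o))).
  rewrite (u1dot _ _ (M1m _) (M1m _)) dot_hsumE /= m1sim.2 dot_hconst dot0l d1.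
  by rewrite addr0 !mulr1.
subst sigma2; have s0 : (sigma1%:C%C : R[i]) != 0 by rewrite gt_eqF// ltcR.
have u0const p : M1 p -> u0 (hconst p.1) = hconst (u1 p).1.
  by move=> /u0c/(scalerI s0).
have M0mon p n : M1 p -> M0 (hmonom n p.1).
  by move=> Mp; elim: n => [|n IHn]; [exact: M1M0|exact: M0sh].
have u0mon p n : M1 p -> u0 (hmonom n p.1) = hmonom n (u1 p).1.
  move=> Mp; elim: n => [|n IHn]; first exact: u0const.
  by rewrite /hmonom !iterS u0sh ?IHn//; exact: M0mon.
have transfer x n p : M0 x -> M1 p -> dot (u0 x n) (u1 p).1 = dot (x n) p.1.
  move=> Mx Mp; rewrite -!dot_hmonomr -u0mon// u0dot//; exact: M0mon.
have alpha p : M1 p -> dot (u1 p).2 (u1 p).2 = dot p.2 p.2.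
  move=> Mp; have MTp : M1 (brownian2 sigma1 theta1 p).
    by have [_ _ + _] := dsum_invariant s10 Minv; exact.
  have := u1dot _ _ MTp MTp; rewrite u1T// !dot_brownian2 u1dot// => /addrI.
  by move=> /(mulfI (expf_neq0 2 s0)).
have K1M k : M0 (K1 k) /\ forall n p, M1 p -> dot (K1 k n) p.1 = 0.
  by have : range K1 (K1 k) by []; rewrite rK1.
have K2N k : N0 (K2 k) /\ forall n p, N1 p -> dot (K2 k n) p.1 = 0.
  by have : range K2 (K2 k) by []; rewrite rK2.
have b12 : b1 = b2.
  case: b1 b2 M1E N1E {modM modN gE1 gE2} => -[] // M1E N1E.
    have Mg : M1 (g1, 1).
      by rewrite M1E; exists 0, 1; rewrite scale1r (similarity0 m1sim) addr0.
    have : N1 (u1 (g1, 1)) by rewrite -u1r; exists (g1, 1).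
    rewrite N1E => -[f [a [/(_ erefl) a0 uE]]].
    have := alpha _ Mg; rewrite uE a0 /= dot0l d1 => /eqP.
    by rewrite eq_sym oner_eq0.
  have : N1 (g2, 1).
    by rewrite N1E; exists 0, 1; rewrite scale1r (similarity0 m2sim) addr0.
  rewrite -u1r => -[p Mp uE]; have := alpha _ Mp; rewrite uE /=.
  move: Mp; rewrite M1E => -[f [a [/(_ erefl) -> ->]]] /eqP.
  by rewrite /= dot0l d1 oner_eq0.
split=> //.
- have [||||W [Wdot Wsurj]] := @wandering_unitary R E1 E2
    (fun k l => u0 (K1 k) = K2 l).
  + move=> k l k' l' kl kl'; rewrite -[LHS]mul1r -K1sim.2 -[RHS]mul1r -K2sim.2.
    by rewrite -kl -kl' u0dot//; [case: (K1M k)|case: (K1M k')].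
  + by move=> k l kl; rewrite K1sh K2sh u0sh ?kl//; case: (K1M k).
  + move=> k; have [MK Kp] := K1M k.
    have : range K2 (u0 (K1 k)); last by move=> [l _ kl]; exists l.
    rewrite rK2; split; first by rewrite -u0r; exists (K1 k).
    by move=> n q; rewrite -u1r => -[p Mp <-]; rewrite transfer// Kp.
  + move=> l; have [NK Kq] := K2N l; move: (NK); rewrite -u0r => -[x Mx xl].
    have : range K1 x; last by move=> [k _ kx]; exists k; rewrite kx.
    rewrite rK1; split=> // n p Mp; rewrite -transfer// xl Kq// -u1r.
    by exists p.
  exact: (same_dimension_unitary Wdot Wsurj).
move=> b1E; have Mg : M1 (g1, 1).
  rewrite M1E; exists 0, 1; rewrite b1E scale1r (similarity0 m1sim) addr0.
  by split.
have Nu : N1 (u1 (g1, 1)) by rewrite -u1r; exists (g1, 1).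
have [f [c [_ uE]]] : exists f (c : R[i]), (b2 = false -> c = 0) /\
    u1 (g1, 1) = (c *: g2 + m2 f, c) by move: Nu; rewrite N1E.
have cc : c * Num.conj c = 1.
  by have := alpha _ Mg; rewrite uE /= d1.
(* [u1 (g1, 1)] is orthogonal to [phi_2 H^2], because [u1] maps [phi_1 H^2]
   onto it; so its component there vanishes. *)
have mf0 : m2 f = 0.
  have : N1 (m2 f, 0) by exact: N1m.
  rewrite -u1r => -[p Mp pE].
  have p2 : p.2 = 0.
    by apply: dot_eq0; rewrite -alpha// pE /= dot0l.
  have [f' pf] : exists f', p = (m1 f', 0).
    move: Mp p2; rewrite M1E => -[f' [a [_ ->]]] /= ->; exists f'.
    by rewrite scale0r add0r.
  apply: dot_eq0; have := u1dot _ _ Mg Mp; rewrite pE uE pf !dot_hsumE /=.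
  by rewrite !dot0r gm1 dotDl dotZl gm2 mulr0 add0r !addr0.
rewrite {f}mf0 addr0 in uE.
have uE' : u1 (g1, 1) = c *: ((g2, 1) : H1C).
  by rewrite uE; congr (_, _); rewrite /GRing.scale /= mulr1.
have udot (x : H1C) : dot (c *: x) (c *: x) = dot x x.
  by rewrite dotZl dotZr mulrA cc mul1r.
have gg : dot g1 g1 = dot g2 g2.
  have := u1dot _ _ Mg Mg; rewrite uE' udot !dot_hsumE /=.
  by move=> /addIr.
split; last exact/dotxx_inj.
have b2E : b2 = true by rewrite -b12.
(* [<T1 v, v> = e^(i theta) |v|^2] for [v = (g, 1)]. *)
have Tdot sigma theta g l m : (forall f, dot g (m f) = 0) ->
    hshift g + sigma%:C%C *: hconst (1 : R[i]^o) =
      expi theta *: g + (sigma%:C%C * Num.conj l) *: m (hconst (1 : R[i]^o)) ->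
    dot (brownian2 sigma theta ((g, 1) : H1C)) ((g, 1) : H1C) =
    expi theta * (dot g g + 1).
  move=> gm gE; rewrite /brownian2 /= gE dot_hsumE /= dotDl !dotZl.
  rewrite (dot_sym0 (gm _)) mulr0 addr0 mulr1 mulrDr mulr1.
  by congr (_ + _); rewrite /dot /= conjC1 mulr1.
have MTg : M1 (brownian2 sigma1 theta1 (g1, 1)).
  by have [_ _ + _] := dsum_invariant s10 Minv; exact.
have := u1dot _ _ MTg Mg; rewrite u1T// uE'.
have -> : brownian2 sigma1 theta2 (c *: ((g2, 1) : H1C)) =
    c *: brownian2 sigma1 theta2 ((g2, 1) : H1C).
  rewrite /brownian2 /=; congr (_, _).
    by rewrite hshiftZ hconstZ scalerDr !scalerA (mulrC c).
  by rewrite /GRing.scale /= mulrCA.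
rewrite dotZl dotZr mulrA cc mul1r (Tdot _ _ _ _ _ gm1 (gE1 b1E)).
rewrite (Tdot _ _ _ _ _ gm2 (gE2 b2E)) gg => /mulIf -> //.
by rewrite gt_eqF// ltr_wpDl// dot_ge0.
Qed.

End model_equivalence.

(** * Construction of the unitary *)

Section model_unitary.
Context (R : realType).
Notation H1C := (hsum (H2 R) R[i]^o).

Lemma hmap_surjective (E F : innerType R[i]) (W : E -> F) (Wsim : similarity 1 W) :
  (forall y, exists x, W x = y) -> forall k, exists k', hmap Wsim k' = k.
Proof.
move=> /choice[V WV] k.
have Vdot x y : dot (V x) (V y) = dot x y.
  by rewrite -[LHS]mul1r -Wsim.2 !WV.
have Winj x y : W x = W y -> x = y.
  move=> xy; apply/eqP; rewrite -subr_eq0; apply/eqP/dot_eq0.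
  rewrite -[LHS]mul1r -Wsim.2 (similarityD Wsim) -scaleN1r (similarityZ Wsim).
  by rewrite scaleN1r xy subrr dot0l.
have Vsim : similarity 1 V.
  split; last by move=> x y; rewrite Vdot mul1r.
  by move=> a x y; apply: Winj; rewrite Wsim.1 !WV.
by exists (hmap Vsim k); apply: hardyP => n; rewrite !hmapE WV.
Qed.

Definition assemble (E : hilbertType R[i]) (g : H2 R) (m : H2 R -> H2 R)
    (J : H2D2 R -> H2D2 R) (G : H2 R -> H2D2 R) (K : hardy E -> H2D2 R)
    (F : H2D2 R) (h : H2 R) (k : hardy E) (f : H2 R) (a : R[i]) :
    brownian_space R :=
  (J F + G h + K k, (a *: g + m f, a)).

Section assemble.
Context (b : bool) (sigma theta : R) (E : hilbertType R[i]) (M0 : set (H2D2 R))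
  (M1 : set H1C) (g : H2 R) (l : R[i]) (m : H2 R -> H2 R)
  (J : H2D2 R -> H2D2 R) (G : H2 R -> H2D2 R) (K : hardy E -> H2D2 R)
  (mod : brownian_model b sigma theta M0 M1 g l m J G K).

Lemma dot_assemble F h k f a F' h' k' f' a' :
  dot (assemble g m J G K F h k f a) (assemble g m J G K F' h' k' f' a') =
  dot F F' + dot g g * dot h h' + dot k k' +
  (a * Num.conj a' * dot g g + dot f f' + a * Num.conj a').
Proof.
have [[msim Jsim _ _] [Gsim _ _] [Ksim _] [JG JK GK gm] _] := mod.
rewrite /assemble !dot_hsumE /= !dotDl !dotDr !dotZl !dotZr.
rewrite JG JK GK gm (dot_sym0 (JG _ _)) (dot_sym0 (JK _ _)) (dot_sym0 (GK _ _)).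
rewrite (dot_sym0 (gm _)) msim.2 Jsim.2 Gsim.2 Ksim.2.
rewrite {9}/dot /=.
by rewrite !mulr0 !addr0 !add0r !mul1r mulrA.
Qed.

Lemma brownian_shift_assemble F h k f a : (b = false -> a = 0) ->
  brownian_shift sigma theta (assemble g m J G K F h k f a) =
  assemble g m J G K (hshift F + sigma%:C%C *: hconst f)
    (hshift h + sigma%:C%C *: hconst (a : R[i]^o)) (hshift k)
    (hshift f + (a * (sigma%:C%C * Num.conj l)) *: hconst (1 : R[i]^o))
    (expi theta * a).
Proof.
have [[msim Jsim msh JE] [Gsim GE g0] [Ksim Ksh] _ [_ _ _ gE]] := mod.
move=> a0; rewrite brownian_shiftE /brownian2 /assemble; congr (_, (_, _)).
  have Jsh x : J (hshift x) = hshift (J x).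
    by apply: hardyP => -[|n]; rewrite JE /= ?JE//; exact: (similarity0 msim).
  have Gsh x : G (hshift x) = hshift (G x).
    by apply: hardyP => -[|n]; rewrite GE /= ?GE// scale0r.
  have Jc x : J (hconst x) = hconst (m x).
    by apply: hardyP => -[|n]; rewrite JE /= ?JE//; exact: (similarity0 msim).
  have Gc (x : R[i]^o) : G (hconst x) = hconst ((x : R[i]) *: g).
    by apply: hardyP => -[|n]; rewrite GE /= ?GE// scale0r.
  rewrite (similarityD Jsim) (similarityD Gsim) (similarityZ Jsim).
  rewrite (similarityZ Gsim) Jsh Gsh Jc Gc Ksh [X in hconst X]/=.
  rewrite hconstD !hshiftD scalerDr.
  move: (hshift (J F)) (hshift (G h)) (hshift (K k)) => x y z.
  rewrite -!addrA; congr (_ + _); rewrite [RHS]addrCA; congr (_ + _).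
  rewrite [LHS]addrC -[LHS]addrA [LHS]addrCA; congr (_ + _).
rewrite [X in hshift X]/= [X in hconst X]/= hshiftD hshiftZ.
rewrite (similarityD msim) (similarityZ msim) msh.
case: b gE a0 g0 => [/(_ erefl) gE _ _|_ /(_ erefl) -> /(_ erefl) ->]; last first.
  by rewrite !(mulr0, mul0r, scale0r, scaler0, hconst0, addr0, add0r).
have -> : hconst (a : R[i]^o) = a *: hconst (1 : R[i]^o).
  by rewrite -hconstZ /GRing.scale /= mulr1.
have -> : sigma%:C%C *: (a *: hconst (1 : R[i]^o)) =
    a *: (sigma%:C%C *: hconst (1 : R[i]^o)) by rewrite !scalerA mulrC.
rewrite addrAC -scalerDr gE scalerDr !scalerA (mulrC a (expi theta)).
by rewrite -addrA (addrC (_ *: m _)).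
Qed.

Lemma dsum_range_assemble :
  dsum M0 M1 = [set x | exists F h k f a, (b = false -> a = 0) /\
    x = assemble g m J G K F h k f a].
Proof.
have [_ _ _ _ [-> -> _ _]] := mod.
apply/seteqP; split=> [[x y] [/= [F [h [k ->]]] [f [a [a0 ->]]]]|].
  by exists F, h, k, f, a.
move=> _ [F [h [k [f [a [a0 ->]]]]]].
by split; [exists F, h, k|exists f, a].
Qed.

End assemble.

Lemma model_equivalent b sigma theta1 theta2
    (E1 E2 : hilbertType R[i]) (M0 N0 : set (H2D2 R)) (M1 N1 : set H1C)
    g1 l1 m1 J1 G1 (K1 : hardy E1 -> H2D2 R)
    g2 l2 m2 J2 G2 (K2 : hardy E2 -> H2D2 R) :
  Defs.subspace (dsum M0 M1) ->
  brownian_model b sigma theta1 M0 M1 g1 l1 m1 J1 G1 K1 ->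
  brownian_model b sigma theta2 N0 N1 g2 l2 m2 J2 G2 K2 ->
  same_dimension E1 E2 -> `|g1| = `|g2| -> (b = true -> theta1 = theta2) ->
  unitarily_equivalent (brownian_shift sigma theta1) (dsum M0 M1)
    (brownian_shift sigma theta2) (dsum N0 N1).
Proof.
move=> Msub modM modN /same_dimension_exists_unitary[W [Wsim Wsurj]].
move=> /dotxx_inj gg tE.
have [_ _ _ _ [_ _ nl1 _]] := modM; have [_ _ _ _ [_ _ nl2 _]] := modN.
have ll1 : l1 * Num.conj l1 = 1 by rewrite -normCK nl1 expr1n.
have ll2 : l2 * Num.conj l2 = 1 by rewrite -normCK nl2 expr1n.
(* In the coordinate [f], [T1 (g, 1)] has the entry [sigma (conj l)], so the
   rotation of [F] and [f] has to turn [conj l1] into [conj l2]. *)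
pose c := Num.conj l2 * l1.
have cl : c * Num.conj l1 = Num.conj l2 by rewrite /c -mulrA ll1 mulr1.
have cc : c * Num.conj c = 1.
  rewrite /c rmorphM /= conjCK mulrACA ll1 mulr1 mulrC; exact: ll2.
have cdot (H : innerType R[i]) (x y : H) : dot (c *: x) (c *: y) = dot x y.
  by rewrite dotZl dotZr mulrA cc mul1r.
have cK (H : innerType R[i]) (x : H) : c *: (Num.conj c *: x) = x.
  by rewrite scalerA cc scale1r.
pose X : Type :=
  (H2D2 R * H2 R * hardy E1 * H2 R * {a : R[i] | b = false -> a = 0})%type.
pose P (x : X) := let: (F, h, k, f, a) := x in
  assemble g1 m1 J1 G1 K1 F h k f (sval a).
pose Q (x : X) := let: (F, h, k, f, a) := x in
  assemble g2 m2 J2 G2 K2 (c *: F) h (hmap Wsim k) (c *: f) (sval a).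
apply: (unitarily_equivalent_gram (P := P) (Q := Q) Msub).
- rewrite (dsum_range_assemble modM); apply/seteqP; split.
    by move=> _ [F [h [k [f [a [a0 ->]]]]]]; exists (F, h, k, f, exist _ a a0).
  move=> _ [[[[[F h] k] f] [a a0]] _ <-].
  by exists F, h, k, f, a.
- rewrite (dsum_range_assemble modN); apply/seteqP; split.
    move=> _ [F [h [k [f [a [a0 ->]]]]]].
    have [k' <-] := hmap_surjective Wsim Wsurj k.
    exists (Num.conj c *: F, h, k', Num.conj c *: f, exist _ a a0) => //.
    by rewrite /Q !cK.
  move=> _ [[[[[F h] k] f] [a a0]] _ <-].
  by exists (c *: F), h, (hmap Wsim k), (c *: f), a.
- move=> [[[[F h] k] f] [a a0]] [[[[F' h'] k'] f'] [a' a0']] /=.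
  rewrite (dot_assemble modM) (dot_assemble modN) !cdot gg.
  by rewrite (hmap_similarity Wsim).2 mul1r.
- move=> [[[[F h] k] f] [a a0]].
  have a0' : b = false -> expi theta1 * a = 0 by move=> /a0 ->; rewrite mulr0.
  exists (hshift F + sigma%:C%C *: hconst f,
    hshift h + sigma%:C%C *: hconst (a : R[i]^o), hshift k,
    hshift f + (a * (sigma%:C%C * Num.conj l1)) *: hconst (1 : R[i]^o),
    exist _ (expi theta1 * a) a0').
    exact: (brownian_shift_assemble modM F h k f a0).
  have eF : hshift (c *: F) + sigma%:C%C *: hconst (c *: f) =
      c *: (hshift F + sigma%:C%C *: hconst f).
    by rewrite hshiftZ hconstZ scalerDr !scalerA mulrC.
  have ef : hshift (c *: f) + (a * (sigma%:C%C * Num.conj l2)) *: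
        hconst (1 : R[i]^o) =
      c *: (hshift f + (a * (sigma%:C%C * Num.conj l1)) *: hconst (1 : R[i]^o)).
    by rewrite hshiftZ scalerDr scalerA -cl; congr (_ + _ *: _); ring.
  have ea : expi theta2 * a = expi theta1 * a.
    case: b tE a0 {modM modN P Q a0' X} => [/(_ erefl) -> //|_ /(_ erefl) ->].
    by rewrite !mulr0.
  rewrite [LHS](brownian_shift_assemble modN (c *: F) h (hmap Wsim k) (c *: f) a0).
  by rewrite eF ef ea -(hmap_hshift Wsim).
Qed.

End model_unitary.

(** * The classification *)

Lemma lifted_model (R : realType) (sigma theta : R) (E : hilbertType R[i])
    (M0 : set (H2D2 R)) (M1 : set (hsum (H2 R) R[i]^o)) : 0 < sigma ->
  lifted_typeI E M0 M1 \/ lifted_typeII sigma theta E M0 M1 ->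
  exists b g l m J G (K : hardy E -> H2D2 R),
    [/\ brownian_model b sigma theta M0 M1 g l m J G K,
        b = false -> lifted_typeI E M0 M1 &
        b = true -> exists phi (Psi : R[i] -> E -> H2 R),
          lifted_typeII_with sigma theta M0 M1 phi g Psi].
Proof.
move=> sigma0 [MI|[phi [g [Psi MII]]]].
  have [g [l [m [J [G [K mod]]]]]] := typeI_model sigma theta MI.
  by exists false, g, l, m, J, G, K; split.
have [l [m [J [G [K mod]]]]] := typeII_model sigma0 MII.
by exists true, g, l, m, J, G, K; split=> // _; exists phi, Psi.
Qed.

Theorem theorem1p1 (R : realType) (theta1 theta2 sigma1 sigma2 : R)
    (theta1_range : 0 <= theta1 < 2 * pi) (theta2_range : 0 <= theta2 < 2 * pi)
    (sigma1_gt0 : 0 < sigma1) (sigma2_gt0 : 0 < sigma2)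
    (EM EN : hilbertType R[i]) (EM_sep : separable EM) (EN_sep : separable EN)
    (M0 N0 : set (H2D2 R)) (M1 N1 : set (hsum (H2 R) R[i]^o))
    (M_inv : closed_invariant_subspace (brownian_shift sigma1 theta1) (dsum M0 M1))
    (N_inv : closed_invariant_subspace (brownian_shift sigma2 theta2) (dsum N0 N1))
    (M_neq0 : dsum M0 M1 <> [set 0]) (N_neq0 : dsum N0 N1 <> [set 0])
    (M_lifted : lifted_typeI EM M0 M1 \/ lifted_typeII sigma1 theta1 EM M0 M1)
    (N_lifted : lifted_typeI EN N0 N1 \/ lifted_typeII sigma2 theta2 EN N0 N1) :
  unitarily_equivalent (brownian_shift sigma1 theta1) (dsum M0 M1)
    (brownian_shift sigma2 theta2) (dsum N0 N1) <->
  [/\ sigma1 = sigma2,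
      same_dimension EM EN &
      (lifted_typeI EM M0 M1 /\ lifted_typeI EN N0 N1) \/
      (exists (phi1 phi2 : R[i] -> R[i]) (g1 g2 : H2 R)
         (Psi1 : R[i] -> EM -> H2 R) (Psi2 : R[i] -> EN -> H2 R),
         [/\ lifted_typeII_with sigma1 theta1 M0 M1 phi1 g1 Psi1,
             lifted_typeII_with sigma2 theta2 N0 N1 phi2 g2 Psi2,
             theta1 = theta2 &
             `|g1| = `|g2|])].
Proof.
have Msub : Defs.subspace (dsum M0 M1) by case: M_inv.
split=> [MN|[sE dimE]].
  have [b1 [g1 [l1 [m1 [J1 [G1 [K1 [modM MI MII]]]]]]]] :=
    lifted_model sigma1_gt0 M_lifted.
  have [b2 [g2 [l2 [m2 [J2 [G2 [K2 [modN NI NII]]]]]]]] :=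
    lifted_model sigma2_gt0 N_lifted.
  have [sE dimE bE gE] := model_equivalent_invariants sigma1_gt0 sigma2_gt0
    M_inv N_inv modM modN MN.
  split; [exact: sE|exact: dimE|].
  case: b1 b2 bE gE MI MII NI NII {modM modN} => -[]// _ gE MI MII NI NII.
    right; have [phi1 [Psi1 M1E]] := MII erefl.
    have [phi2 [Psi2 N1E]] := NII erefl.
    have [eE nE] := gE erefl.
    exists phi1, phi2, g1, g2, Psi1, Psi2; split; [exact: M1E|exact: N1E| |].
      exact: expi_inj.
    exact: nE.
  by left; split; [exact: MI|exact: NI].
subst sigma2; case=> [[MI NI]|[phi1 [phi2 [g1 [g2 [Psi1 [Psi2 [MII NII tE nE]]]]]]]].
  have [g1 [l1 [m1 [J1 [G1 [K1 modM]]]]]] := typeI_model sigma1 theta1 MI.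
  have [g2 [l2 [m2 [J2 [G2 [K2 modN]]]]]] := typeI_model sigma1 theta2 NI.
  apply: (model_equivalent Msub modM modN dimE) => //.
  have [_ [_ _ g10] _ _ _] := modM; have [_ [_ _ g20] _ _ _] := modN.
  by rewrite g10// g20.
have [l1 [m1 [J1 [G1 [K1 modM]]]]] := typeII_model sigma1_gt0 MII.
have [l2 [m2 [J2 [G2 [K2 modN]]]]] := typeII_model sigma1_gt0 NII.
exact: (model_equivalent Msub modM modN dimE nE (fun _ => tE)).
Qed.
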